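(* Let $N\ge 1$ and let $g\in C^{2}(\mathbb{R}^N)$ be a (radial) definitively non-decreasing function such that $\lim_{|x|\to+\infty}g(x)=+\infty$. Let $(m_j)_j$ be any sequence of positive numbers with $m_j\searrow 0$, and for each $j$ let $f_j$ be a minimizer of $$\min\Bigl\{\mathcal{E}(h) : h\in L^1(\mathbb{R}^N),\ 0\le h\le 1,\ \|h\|_1=m_j\Bigr\}.$$ Assume that $m_j^{-1}f_j\overset{\ast}{\rightharpoonup}\mu$ for some $\mu\in\mathcal{P}(\mathbb{R}^N)$. If $\psi_\mu>\mathcal{E}(\mu)$ in $\mathbb{R}^N\setminus\operatorname{spt}\mu$, and for every $x\in\operatorname{spt}\mu$ there exists $v\in\mathbb{S}^{N-1}$ such that $\partial_v^2\psi_\mu(x)>0$, then $f_j$ is the characteristic function of a set (up to Lebesgue-null sets) when $j$ is large enough.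
   Context: A radial function $g:\mathbb{R}^N\to\mathbb{R}$ is written $g(t)=g(x)$ for $|x|=t$. It is called definitively non-decreasing if there is $\overline R\ge 0$ such that $g(s)\ge g(t)$ for all $s\ge t\ge\overline R$ (radiality is part of the definition). For a density $h\in L^1(\mathbb{R}^N;[0,1])$, $\mathcal{E}(h)=\int_{\mathbb{R}^N}\int_{\mathbb{R}^N} g(x-y)h(x)h(y)\,dx\,dy$; for a finite positive measure $\mu$, $\mathcal{E}(\mu)=\iint g(x-y)\,d\mu(x)\,d\mu(y)$, and its potential is $\psi_\mu(x)=\int g(x-y)\,d\mu(y)$. $\mathcal{P}(\mathbb{R}^N)$ denotes the Borel probability measures on $\mathbb{R}^N$. A density $f$ is identified with the measure $f\,dx$, and $\overset{\ast}{\rightharpoonup}$ is weak-* convergence of measures. $\partial_v^2$ is the second derivative in direction $v$. *)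

(* Defs.v *)
From HB Require Import structures.
From mathcomp Require Import all_boot all_order all_algebra.
From mathcomp Require Import all_classical all_reals all_analysis measurable_realfun.

Set Implicit Arguments.
Unset Strict Implicit.
Unset Printing Implicit Defensive.
Import Order.TTheory GRing.Theory Num.Theory.
Import numFieldNormedType.Exports.

Local Open Scope classical_set_scope.
Local Open Scope ring_scope.

Definition mx_borel_display : measure_display -> measure_display.
Proof. exact. Qed.

Section borel_matrix.
Context (R : realType) (m n : nat).

Definition mx_borel : set (set 'M[R]_(m, n)) := <<s open >>.

Let mx_borelC A : mx_borel A -> mx_borel (~` A).
Proof. exact: sigma_algebraC. Qed.

HB.instance Definition _ := @isMeasurable.Build
  (mx_borel_display default_measure_display) 'M[R]_(m, n) mx_borel
  (@sigma_algebra0 _ setT open) mx_borelC (@sigma_algebra_bigcup _ setT open).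

Lemma mx_open_measurable (U : set 'M[R]_(m, n)) : open U -> measurable U.
Proof. by move=> oU; exact: sub_sigma_algebra. Qed.

End borel_matrix.

Section lebesgue_rV_step.
Context (R : realType) (n : nat).

Definition rV_cons (p : measurableTypeR R * 'rV[R]_n) : 'rV[R]_n.+1 :=
  row_mx (p.1 : R)%:M p.2 : 'rV[R]_(1 + n).

Definition rV_uncons (x : 'rV[R]_n.+1) : measurableTypeR R * 'rV[R]_n :=
  (x ord0 ord0, rsubmx (x : 'rV[R]_(1 + n))).

Lemma rV_consK : cancel rV_cons rV_uncons.
Proof.
move=> [a v]; rewrite /rV_cons /rV_uncons /= row_mxKr; congr pair.
have -> : ord0 = lshift n (ord0 : 'I_1) by exact/val_inj.
by rewrite (row_mxEl (a : R)%:M v) mxE eqxx mulr1n.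
Qed.

Lemma ball_rV_cons (c : 'rV[R]_n.+1) (e : R) : 0 < e ->
  rV_cons @^-1` ball c e = ball ((rV_uncons c).1 : R) e `*` ball (rV_uncons c).2 e.
Proof.
move=> e0; apply/seteqP; split => [[a v]|[a v] [/= ba [_ bv]]] /=.
  move=> [_ b]; split => /=; last split => // i j.
    by have := b ord0 ord0; rewrite -[X in ball _ _ X]/((rV_uncons (rV_cons (a, v))).1) rV_consK.
  have := b i (rshift 1 j); rewrite /rV_cons (row_mxEr (a : R)%:M v) /= mxE.
  by rewrite (ord1 i).
split => // i j; rewrite (ord1 i).
have [k ->|k ->] := split_ordP (j : 'I_(1 + n)); rewrite /rV_cons.
  rewrite (row_mxEl (a : R)%:M v) mxE !ord1 eqxx mulr1n.
  by rewrite (_ : lshift n 0 = ord0)//; exact/val_inj.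
by rewrite (row_mxEr (a : R)%:M v); have := bv ord0 k; rewrite mxE.
Qed.

Lemma rat_ball_rV (U : set 'rV[R]_n.+1) : open U ->
  U = \bigcup_(p in [set p : 'rV[rat]_n.+1 * nat |
         ball (map_mx ratr p.1 : 'rV[R]_n.+1) p.2.+1%:R^-1 `<=` U])
       ball (map_mx ratr p.1 : 'rV[R]_n.+1) p.2.+1%:R^-1.
Proof.
move=> oU; apply/seteqP; split => [x Ux|x [p pU /pU//]].
have /nbhs_ballP[e /= e0 xeU] : nbhs x U by exact: open_nbhs_nbhs.
have [k ke] : exists k : nat, k.+1%:R^-1 < e / 2.
  have e2 : 0 < e / 2 by rewrite divr_gt0.
  have := near_infty_natSinv_lt (PosNum e2).
  by case=> k _ kP; exists k; exact: (kP k (leqnn _)).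
have k0 : 0 < k.+1%:R^-1 :> R by rewrite invr_gt0.
have qP (j : 'I_n.+1) : exists q : rat, ball (x ord0 j) k.+1%:R^-1 (ratr q : R).
  have /rat_in_itvoo[q] : x ord0 j - k.+1%:R^-1 < x ord0 j + k.+1%:R^-1.
    by rewrite ltrBlDr -addrA ltrDl addr_gt0.
  by rewrite in_itv /= => /andP[q1 q2]; exists q; rewrite /ball /= ltr_distlC q1.
pose q j := projT1 (cid (qP j)).
have xq : ball (map_mx ratr (\row_j q j) : 'rV[R]_n.+1) k.+1%:R^-1 x.
  split => // i j; rewrite !mxE (ord1 i); apply: ball_sym.
  exact: (projT2 (cid (qP j))).
exists (\row_j q j, k) => //= y qy; apply: xeU.
rewrite (splitr e); apply: (ball_triangle (y := map_mx ratr (\row_j q j) : 'rV[R]_n.+1)).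
  by apply: ball_sym; exact: le_ball (ltW ke) _ xq.
exact: le_ball (ltW ke) _ qy.
Qed.

Lemma measurable_rV_cons : measurable_fun setT rV_cons.
Proof.
apply: (@measurability _ _ _ _ _ _ (@open 'rV[R]_n.+1)) => //.
move=> _ [U oU <-]; rewrite setTI (rat_ball_rV oU) preimage_bigcup bigcup_mkcond.
apply: countable_bigcupT_measurable => // -[q k]; case: ifPn => // _.
rewrite ball_rV_cons ?invr_gt0//; apply: measurableX.
  by apply: open_measurable; exact: ball_open.
apply: mx_open_measurable; exact: ball_open.
Qed.

Lemma measurable_rV_uncons : measurable_fun setT rV_uncons.
Proof.
apply: measurable_fun_pair.
  apply: (@measurability _ _ _ (measurableTypeR R) _ _ (@RGenOpens.G R)).
    exact: RGenOpens.measurableE.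
  move=> _ [_ [a [b ->]] <-]; rewrite setTI; apply: mx_open_measurable.
  apply: open_comp; last exact: interval_open.
  by move=> x _; exact: coord_continuous.
apply: (@measurability _ _ _ _ _ _ (@open 'rV[R]_n)) => //.
move=> _ [U oU <-]; rewrite setTI; apply: mx_open_measurable.
by apply: open_comp => // x _; exact: (@continuous_rsubmx R 1 1 n).
Qed.

Variable mu : {sigma_finite_measure set 'rV[R]_n -> \bar R}.

Definition lebesgue_rV_step : set 'rV[R]_n.+1 -> \bar R :=
  pushforward (@lebesgue_measure R \x mu)%E rV_cons.

Let mcons := measurable_rV_cons.

Let step0 : lebesgue_rV_step set0 = 0%E.
Proof. exact: measure0. Qed.

Let step_ge0 A : (0 <= lebesgue_rV_step A)%E.
Proof. exact: measure_ge0. Qed.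

Let step_sigma_additive : semi_sigma_additive lebesgue_rV_step.
Proof. exact: measure_semi_sigma_additive. Qed.

HB.instance Definition _ := isMeasure.Build _ _ _ lebesgue_rV_step
  step0 step_ge0 step_sigma_additive.

Let step_sigma_finite : sigma_finite setT lebesgue_rV_step.
Proof.
have /sigma_finiteP[F [TF ndF Foo]] := sigma_finiteT (@lebesgue_measure R).
have /sigma_finiteP[G [TG ndG Goo]] := sigma_finiteT mu.
exists (fun k => rV_uncons @^-1` (F k `*` G k)).
  apply/esym; rewrite -subTset => x _.
  have [i _ Fi] : (\bigcup_i F i) (rV_uncons x).1 by rewrite -TF.
  have [j _ Gj] : (\bigcup_j G j) (rV_uncons x).2 by rewrite -TG.
  exists (maxn i j) => //=; split.
    by move: Fi; exact/subsetPset/ndF/leq_maxl.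
  by move: Gj; exact/subsetPset/ndG/leq_maxr.
move=> k; have [mF Fk] := Foo k; have [mG Gk] := Goo k; split.
  rewrite -[X in measurable X]setTI.
  by apply: measurable_rV_uncons => //; exact: measurableX.
rewrite /lebesgue_rV_step /pushforward -comp_preimage.
rewrite (_ : rV_uncons \o rV_cons = id); last first.
  by apply/funext => p; exact: rV_consK.
by rewrite preimage_id product_measure1E// lte_mul_pinfty// ge0_fin_numE.
Qed.

HB.instance Definition _ := Measure_isSigmaFinite.Build _ _ _ lebesgue_rV_step
  step_sigma_finite.

End lebesgue_rV_step.
Arguments rV_cons {R n} p.
Arguments rV_uncons {R n} x.

(* The pushforward of lambda_1 x ... x lambda_1; `lebesgue_rV_box` checks the
   normalization on boxes. *)
Fixpoint lebesgue_rV (R : realType) (n : nat) :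
    {sigma_finite_measure set 'rV[R]_n -> \bar R} :=
  if n isn't k.+1 then \d_(0 : 'rV[R]_0) else lebesgue_rV_step (lebesgue_rV R k).

Lemma lebesgue_rV_box (R : realType) (n : nat) (a b : 'rV[R]_n) :
  (forall i, a ord0 i <= b ord0 i) ->
  lebesgue_rV R n [set x | forall i, a ord0 i <= x ord0 i <= b ord0 i] =
  (\prod_(i < n) (b ord0 i - a ord0 i))%:E.
Proof.
elim: n a b => [|n IH] a b ab.
  rewrite big_ord0 /= diracE mem_set// => -[] //.
pose tl (x : 'rV[R]_n.+1) := (rV_uncons x).2.
have tlE (x : 'rV[R]_n.+1) i : tl x ord0 i = x ord0 (lift ord0 i).
  by rewrite /tl mxE; congr (x _ _); exact/val_inj.
have preE : @rV_cons R n @^-1`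
    [set x : 'rV[R]_n.+1 | forall i, a ord0 i <= x ord0 i <= b ord0 i] =
    `[a ord0 ord0, b ord0 ord0] `*`
    [set v : 'rV[R]_n | forall i, tl a ord0 i <= v ord0 i <= tl b ord0 i].
  have c0 (p : measurableTypeR R * 'rV[R]_n) : rV_cons p ord0 ord0 = p.1.
    by rewrite -[RHS]/((p.1, p.2).1) -{2}[p]rV_consK.
  have cS (p : measurableTypeR R * 'rV[R]_n) (i : 'I_n) : rV_cons p ord0 (lift ord0 i) = p.2 ord0 i.
    by have := tlE (rV_cons p) i; rewrite /tl rV_consK => ->.
  apply/seteqP; split => [p pab|p [/= p1 p2] i] /=.
    split; first by have := pab ord0; rewrite c0 /= in_itv.
    by move=> i; have := pab (lift ord0 i); rewrite cS !tlE.
  have [->|[k ->]] : i = ord0 \/ exists k, i = lift ord0 k.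
    by case: (unliftP ord0 i) => [k ->|->]; [right; exists k|left].
  - by rewrite c0; move: p1; rewrite in_itv.
  by rewrite cS -!tlE; exact: p2.
have mbox : measurable
    [set v : 'rV[R]_n | forall i, tl a ord0 i <= v ord0 i <= tl b ord0 i].
  rewrite (_ : [set _ | _] = ~` \bigcup_(i in [set: 'I_n])
      ((fun v : 'rV[R]_n => v ord0 i) @^-1` (~` `[tl a ord0 i, tl b ord0 i]))).
    apply: measurableC; apply: mx_open_measurable; apply: bigcup_open => i _.
    apply: open_comp; first by move=> x _; exact: coord_continuous.
    exact/closed_openC/interval_closed.
  apply/seteqP; split => v /=.
    by move=> vab [i _] /=; apply; rewrite in_itv; exact: vab.
  move=> nv i; apply: contrapT => vi; apply: nv; by exists i.
rewrite /= /lebesgue_rV_step /pushforward preE product_measure1E//.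
rewrite big_ord_recl EFinM; congr *%E.
  transitivity (lebesgue_measure (`[a ord0 ord0, b ord0 ord0]%classic : set R)).
    by [].
  rewrite lebesgue_measure_itv /= lte_fin.
  by case: ltgtP (ab ord0) => [//|//|->]; rewrite subrr.
rewrite IH; last by move=> i; rewrite !tlE.
by congr EFin; apply: eq_bigr => i _; rewrite !tlE.
Qed.

Section energy.
Context (R : realType) (N : nat).
Local Notation V := 'rV[R]_N.
Implicit Types (g h : V -> R) (mu : {measure set V -> \bar R}).

(* The library norm `|x| on 'rV[R]_N is the sup norm, hence this definition. *)
Definition enorm (x : V) : R := Num.sqrt (\sum_(i < N) x ord0 i ^+ 2).

(* g is of class C^k: all iterated partial derivatives up to order k exist
   everywhere and are continuous. *)
Fixpoint Ck (k : nat) g : Prop :=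
  if k isn't k'.+1 then continuous g else
  continuous g /\
  forall i : 'I_N, (forall x, derivable g x (delta_mx ord0 i)) /\
                   Ck k' ('D_(delta_mx ord0 i) g).

(* G is the profile of the radial function g; its values on negative numbers
   are irrelevant. *)
Definition definitively_nondecreasing g : Prop :=
  exists G : R -> R, (forall x, g x = G (enorm x)) /\
    exists2 Rbar : R, 0 <= Rbar & forall s t, Rbar <= t -> t <= s -> G t <= G s.

Definition diverges_at_infinity g : Prop :=
  forall M : R, exists r : R, forall x, r <= enorm x -> M <= g x.

(* The energies and the potential are extended real numbers: g is unbounded
   above, so they can be +oo for a measure without compact support. *)
Definition density_energy g h : \bar R :=
  (\int[lebesgue_rV R N]_x \int[lebesgue_rV R N]_y
     (g (x - y)%R * h x * h y)%:E)%E.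

Definition potential g mu (x : V) : \bar R := (\int[mu]_y (g (x - y)%R)%:E)%E.

Definition measure_energy g mu : \bar R :=
  (\int[mu]_x \int[mu]_y (g (x - y)%R)%:E)%E.

(* Elements of L^1 are given by Borel representatives, so the pointwise
   constraint is only required almost everywhere. *)
Definition admissible (m : R) h : Prop :=
  [/\ (lebesgue_rV R N).-integrable setT (EFin \o h),
      {ae lebesgue_rV R N, forall x, 0 <= h x <= 1} &
      ('N[lebesgue_rV R N]_1 [EFin \o h] = m%:E)%E].

Definition minimizer g (m : R) f : Prop :=
  admissible m f /\
  forall h, admissible m h -> (density_energy g f <= density_energy g h)%E.

(* Weak-* convergence of the measures u_j dx to mu, tested on C_c. *)
Definition weak_star_cvg (u : nat -> V -> R) mu : Prop :=
  forall phi : V -> R, continuous phi ->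
    compact (closure [set x | phi x != 0]) ->
  (\int[lebesgue_rV R N]_x (phi x * u j x)) @[j --> \oo] -->
  (\int[mu]_x phi x).

Definition spt mu : set V :=
  [set x | forall U, open U -> U x -> (0 < mu U)%E].

Definition is_characteristic f : Prop :=
  exists2 A : set V, measurable A &
    {ae lebesgue_rV R N, forall x, f x = \1_A x :> R}.

End energy.

(* Main.v *)
Require Import Defs.
From mathcomp Require Import all_boot all_order all_algebra.
From mathcomp Require Import finmap all_classical all_reals all_analysis.
From mathcomp Require Import measurable_realfun ring lra.
Set Implicit Arguments.
Unset Strict Implicit.
Unset Printing Implicit Defensive.
Import Order.TTheory GRing.Theory Num.Theory.
Import numFieldNormedType.Exports.
Local Open Scope classical_set_scope.
Local Open Scope ring_scope.

(** Write [nu_j] for the probability [f_j / m_j] and [psi_j] for its potential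
    [g * nu_j].  Moving a little mass from a place where [f_j > 0] to a place
    where [f_j < 1] cannot lower the energy, so up to null sets [psi_j] is
    no larger on the first set than on the second ([optimal_potential_order]).  Hence
    [psi_j] is almost everywhere equal to a constant on the set where
    [0 < f_j < 1] ([intermediate_level]).  The theorem says that this set is
    null for large [j]; since the [f_j] live in a common ball, it suffices to
    show that it is null near each point [x0] of that ball
    ([negligible_of_local]).

    If [x0] is not in the support of [mu], then [psi_mu(x0) > E(mu)], while
    [psi_mu(z0) <= E(mu)] for some [z0], because [E(mu)] is an average of
    [psi_mu].  For large [j] the strict inequality between the two values
    persists for [psi_j], uniformly near [x0] and near [z0].  Near [z0] there
    is more volume than [m_j], so [f_j < 1] on a non-null part of it, and the
    order between the potentials forbids any mass near [x0]
    ([negligible_where_potential_large]).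

    If [x0] is in the support, then [psi_j] is strictly convex in the direction
    [v] near [x0], so that a level set meets each line parallel to [v] in at
    most two points there ([convolve_no_three_levels]).  Such a set is null: as
    many translates of it as one wishes fit in a bounded region, and they cover
    each point at most twice ([lebesgue_null_of_lines]).

    The comparison of [psi_j] with [psi_mu] is possible because [nu_j]
    converges to [mu] against every continuous function, and not only against
    those of compact support; this is where the common ball
    ([minimizers_supported_in_ball]) comes in.  Adding a constant to [g] changes
    the energy of all competitors by the same amount, so [g >= 0] can be
    assumed.  The normalized energies [e_j = E(f_j) / m_j ^ 2] are nonincreasing
    in [j], because a small multiple of a competitor is a competitor for a
    smaller mass.  For the same reason the restriction of [f_j] to a ball has
    at least the limiting energy per squared mass.  As mass far away has a large
    interaction with the bulk, the fraction of mass outside a fixed ball is at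
    most [e_j - lim e], which tends to zero ([mass_loss_vanishes]).  Once this
    fraction is small, moving everything outside a larger ball into the unit
    cube would strictly lower the energy, so there is nothing there
    ([optimal_no_escape]). *)

(** * Borel sets and Lebesgue measure on row vectors *)

Section comparison_sets.
Context {R : realType} {d} {T : measurableType d}.
Implicit Types p q : T -> R.

Lemma measurable_le_set p q : measurable_fun setT p -> measurable_fun setT q ->
  measurable [set x | p x <= q x].
Proof. by move=> mp mq; rewrite -[X in measurable X]setTI; exact: measurable_fun_le. Qed.

Lemma measurable_lt_set p q : measurable_fun setT p -> measurable_fun setT q ->
  measurable [set x | p x < q x].
Proof.
move=> mp mq; rewrite (_ : [set x | _] = ~` [set x | q x <= p x]).
  by apply: measurableC; exact: measurable_le_set.
by apply/seteqP; split => x /=; rewrite ltNge => /negP.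
Qed.

End comparison_sets.

Lemma natSinv_le {R : realType} (e : R) : 0 < e -> exists k : nat, k.+1%:R^-1 <= e.
Proof.
move=> e0; have := near_infty_natSinv_lt (PosNum e0).
by case=> k _ kP; exists k; apply/ltW/(kP k (leqnn _)).
Qed.

Lemma cvgr0_near_lt {R : realType} (u : nat -> R) (s : R) : u @ \oo --> 0 -> 0 < s ->
  \forall j \near \oo, u j < s.
Proof.
move=> u0 s0; near=> j; have : `|u j| < s by near: j; exact: (cvgr0_norm_lt _ u0).
by apply: le_lt_trans; exact: ler_norm.
Unshelve. all: by end_near. Qed.

Section borel_vectors.
Context {R : realType} {n : nat}.
Local Notation V := 'rV[R]_n.

Lemma continuous_measurable_rV (f : V -> R) : continuous f ->
  measurable_fun setT f.
Proof.
move=> cf; apply: (@measurability _ _ _ (measurableTypeR R) _ _ (@RGenOpens.G R)).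
  exact: RGenOpens.measurableE.
move=> _ [_ [a [b ->]] <-]; rewrite setTI; apply: mx_open_measurable.
by apply: open_comp; [move=> x _; exact: cf | exact: interval_open].
Qed.

Lemma closed_measurable_rV (A : set V) : closed A -> measurable A.
Proof.
by move=> cA; rewrite -(setCK A); apply: measurableC; apply: mx_open_measurable;
  exact: closed_openC.
Qed.

End borel_vectors.

(** The Borel sets of ['rV_n.+1] are generated by the open sets and not
    coordinatewise; the passage between the two is the measurability of
    [rV_cons], used once for each coordinate. *)
Lemma measurable_fun_rV {R : realType} {d} {T : measurableType d} n
    (F : T -> 'rV[R]_n) :
  (forall i, measurable_fun setT (fun t => F t ord0 i : R)) -> measurable_fun setT F.
Proof.
elim: n F => [|n IH] F mF.
  rewrite (_ : F = cst 0); first exact: measurable_cst.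
  by apply/funext => t; rewrite [LHS]thinmx0 [RHS]thinmx0.
have -> : F = rV_cons \o (fun t => rV_uncons (F t)).
  apply/funext => t /=; rewrite /rV_cons /rV_uncons /=.
  apply/rowP => i; have [k ->|k ->] := split_ordP (i : 'I_(1 + n)).
    rewrite (row_mxEl (F t ord0 ord0)%:M _) mxE !ord1 eqxx mulr1n.
    by congr (F t _ _); exact/val_inj.
  by rewrite (row_mxEr (F t ord0 ord0)%:M _) mxE.
apply: measurableT_comp; first exact: measurable_rV_cons.
apply: measurable_fun_pair => /=; first exact: mF.
apply: IH => i; under eq_fun do rewrite mxE; exact: mF.
Qed.

Section coordinates.
Context {R : realType} {n : nat}.
Local Notation V := 'rV[R]_n.

Lemma measurable_coord (i : 'I_n) : measurable_fun setT (fun x : V => x ord0 i : R).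
Proof. by apply: continuous_measurable_rV => x; exact: coord_continuous. Qed.

Lemma measurable_subrV : measurable_fun setT (fun p : V * V => p.1 - p.2).
Proof.
apply: measurable_fun_rV => i; under eq_fun do rewrite !mxE.
apply: measurable_funB.
- exact: (measurableT_comp (measurable_coord i) measurable_fst).
- exact: (measurableT_comp (measurable_coord i) measurable_snd).
Qed.

Lemma measurable_translate (t : V) : measurable_fun setT (fun x : V => x + t).
Proof.
apply: measurable_fun_rV => i; under eq_fun do rewrite !mxE.
by apply: measurable_funD => //; exact: measurable_coord.
Qed.

End coordinates.

Lemma lebesgue_measure_translate {R : realType} (t : R) (A : set R) :
  measurable (A : set (measurableTypeR R)) ->
  lebesgue_measure ((fun x : R => x + t) @^-1` A) = lebesgue_measure A.
Proof.
have mt : measurable_fun (setT : set (measurableTypeR R))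
    ((fun x : R => x + t) : _ -> measurableTypeR R).
  by apply: measurable_funD.
move=> mA; apply/esym.
rewrite -[RHS]/(pushforward (@lebesgue_measure R) ((fun x : R => x + t) : _ -> measurableTypeR R) A).
apply: lebesgue_measure_unique => //= _ [[a b]] _ <-.
rewrite /pushforward (_ : _ @^-1` _ = `]a - t, b - t]%classic).
  rewrite !lebesgue_measure_itv/= !lte_fin ltrD2r.
  by case: ifP => // _; rewrite -!EFinB; congr EFin; ring.
apply/seteqP; split => x /=; rewrite !in_itv/= ltrBlDr lerBrDr//.
Qed.

(** A translation acts factor by factor, and the product measure is determined by
    its values on rectangles. *)
Lemma lebesgue_rV_translate {R : realType} n (t : 'rV[R]_n) (A : set 'rV[R]_n) :
  measurable A -> lebesgue_rV R n ((fun x => x + t) @^-1` A) = lebesgue_rV R n A.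
Proof.
elim: n t A => [|n IH] t A mA.
  congr (_ _); apply/seteqP; split => x /=; rewrite (_ : x + t = x)//;
    by rewrite [LHS]thinmx0 [RHS]thinmx0.
rewrite /= /lebesgue_rV_step /pushforward.
pose a := (rV_uncons t).1 : R; pose v := (rV_uncons t).2.
pose tau (p : measurableTypeR R * 'rV[R]_n) : measurableTypeR R * 'rV[R]_n :=
  ((p.1 : R) + a, p.2 + v).
have mtau : measurable_fun setT tau.
  apply: measurable_fun_pair.
    by apply: measurable_funD => //; exact: measurable_fst.
  exact: (measurableT_comp (measurable_translate v) measurable_snd).
have -> : @rV_cons R n @^-1` ((fun x => x + t) @^-1` A) =
    tau @^-1` (@rV_cons R n @^-1` A).
  have tauE p : rV_cons p + t = rV_cons (tau p).
    apply/rowP => i; rewrite mxE; have [k ->|k ->] := split_ordP (i : 'I_(1 + n)).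
      rewrite /rV_cons (row_mxEl (p.1 : R)%:M _) (row_mxEl ((p.1 : R) + a)%:M _).
      rewrite !mxE !ord1 !eqxx !mulr1n; congr (_ + _); rewrite /a /=.
      by congr (t _ _); exact/val_inj.
    rewrite /rV_cons (row_mxEr (p.1 : R)%:M _) (row_mxEr ((p.1 : R) + a)%:M _) !mxE.
    by congr (_ + _).
  by apply/seteqP; split => p /=; rewrite tauE.
have mA' : measurable (@rV_cons R n @^-1` A).
  by rewrite -[X in measurable X]setTI; exact: measurable_rV_cons.
rewrite -[LHS]/(pushforward (lebesgue_measure \x lebesgue_rV R n)%E tau (@rV_cons R n @^-1` A)).
apply/esym; apply: product_measure_unique => // B C mB mC.
rewrite /= /pushforward.
have -> : tau @^-1` (B `*` C) = ((fun x : R => x + a) @^-1` B) `*` ((fun x => x + v) @^-1` C).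
  by [].
rewrite product_measure1E//.
- by congr (_ * _)%E; [exact: lebesgue_measure_translate | exact: IH].
- rewrite -[X in measurable X]setTI.
  have : measurable_fun (setT : set (measurableTypeR R))
    ((fun x : R => x + a) : _ -> measurableTypeR R) by apply: measurable_funD.
  exact.
- by rewrite -[X in measurable X]setTI; exact: measurable_translate.
Qed.

(** * Balls of the sup norm and null sets *)
Section balls.
Context {R : realType} {n : nat}.
Local Notation V := 'rV[R]_n.
Local Notation leb := (lebesgue_rV R n).

Definition cball (c : V) (r : R) : set V := [set x | `|x - c| <= r].

Lemma normrV_le (x : V) (r : R) : 0 <= r -> (forall i, `|x ord0 i| <= r) -> `|x| <= r.
Proof.
move=> r0 xr; rewrite -[X in X <= _]/(mx_norm x) mx_normrE.
by apply/bigmax_leP; split => // -[i j] _ /=; rewrite (ord1 i).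
Qed.

Lemma coord_le_norm (x : V) i : `|x ord0 i| <= `|x|.
Proof.
rewrite -[leRHS]/(mx_norm x) mx_normrE.
exact: (le_bigmax _ (fun ij : 'I_1 * 'I_n => `|x ij.1 ij.2|) (ord0, i)).
Qed.

Lemma cballP (c : V) r x : 0 <= r ->
  cball c r x <-> (forall i, c ord0 i - r <= x ord0 i <= c ord0 i + r).
Proof.
move=> r0; rewrite /cball /=; split=> [xr i|xr].
  have := le_trans (coord_le_norm (x - c) i) xr; rewrite !mxE ler_norml.
  by move=> /andP[? ?]; apply/andP; split; lra.
apply: normrV_le => // i; have := xr i; rewrite !mxE ler_norml.
by move=> /andP[? ?]; apply/andP; split; lra.
Qed.

Lemma cball0_subr (r s t : R) (x y : V) : cball 0 r x -> cball 0 s y -> r + s <= t ->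
  cball 0 t (x - y).
Proof.
rewrite /cball /= !subr0 => xr ys; apply: le_trans.
by rewrite (le_trans (ler_normB _ _))// lerD.
Qed.

Lemma cball0_far (r s : R) (x y : V) : cball 0 r x -> ~ cball 0 (r + s) y -> s <= `|x - y|.
Proof.
rewrite /cball /= !subr0 => xr /negP; rewrite -ltNge => ys.
by have := ler_normB (x - y) x; rewrite addrAC subrr sub0r normrN; lra.
Qed.

Lemma closed_cball c r : closed (cball c r).
Proof.
rewrite (_ : cball c r = (fun x => `|x - c|) @^-1` [set y | y <= r])//.
apply: preimage_closed; last exact: closed_le.
move=> x _; apply: (@continuous_comp _ _ _ (fun y : V => y - c) (fun y => `|y|)).
  by apply: (@cvgB R V V (nbhs x) _ id (cst c) x c); [exact: cvg_id|exact: cvg_cst].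
exact: norm_continuous.
Qed.

Lemma compact_cball c r : compact (cball c r).
Proof.
apply: bounded_closed_compact; last exact: closed_cball.
exists (r + `|c|); split; first by rewrite num_real.
move=> M rM x /= xr; rewrite -(subrK c x) (le_trans (ler_normD _ _))//.
by rewrite (le_trans _ (ltW rM))// lerD2r.
Qed.

Lemma measurable_cball c r : measurable (cball c r).
Proof. by apply: closed_measurable_rV; exact: closed_cball. Qed.

Lemma lebesgue_cball c r : 0 <= r -> leb (cball c r) = ((r *+ 2) ^+ n)%:E.
Proof.
move=> r0; pose u := const_mx r : V.
rewrite (_ : cball c r =
  [set x | forall i, (c - u) ord0 i <= x ord0 i <= (c + u) ord0 i]); last first.
  apply/seteqP; split => x.
    by move=> /(cballP _ _ r0) h i; rewrite !mxE; exact: h.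
  by move=> h; apply/(cballP _ _ r0) => i; have := h i; rewrite !mxE.
rewrite lebesgue_rV_box.
  rewrite (eq_bigr (fun=> r *+ 2)); last by move=> i _; rewrite !mxE; ring.
  by rewrite prodr_const card_ord.
by move=> i; rewrite !mxE; lra.
Qed.

Lemma lebesgue_cball_lty c r : (leb (cball c r) < +oo)%E.
Proof.
have [r0|r0] := leP 0 r; first by rewrite lebesgue_cball// ltry.
rewrite (_ : cball c r = set0) ?measure0//; apply/seteqP; split => x //=.
by rewrite /cball /= leNgt (lt_le_trans r0).
Qed.

Lemma lebesgue_cball_gt0 c r : 0 < r -> (0 < leb (cball c r))%E.
Proof. by move=> r0; rewrite lebesgue_cball ?ltW// lte_fin exprn_gt0// pmulrn_rgt0. Qed.

(** A set of volume one in every dimension, which therefore carries a competitor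
    of any mass [m <= 1]. *)
Definition unit_cube : set V := [set x | forall i, 0 <= x ord0 i <= 1].

Lemma measurable_unit_cube : measurable unit_cube.
Proof.
rewrite (_ : unit_cube = cball (const_mx 2^-1) 2^-1); first exact: measurable_cball.
apply/seteqP; split => x.
  by move=> h; apply/cballP => // i; have := h i; rewrite !mxE; lra.
by move=> /cballP h i; have := h _ i; rewrite !mxE invr_ge0 ler0n => /(_ isT); lra.
Qed.

Lemma lebesgue_unit_cube : leb unit_cube = 1%E.
Proof.
have -> : unit_cube = [set x | forall i, (0 : V) ord0 i <= x ord0 i <= (const_mx 1 : V) ord0 i].
  by apply/seteqP; split => x h i; have := h i; rewrite !mxE.
rewrite lebesgue_rV_box; last by move=> i; rewrite !mxE.
by rewrite big1// => i _; rewrite !mxE subr0.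
Qed.

Lemma unit_cube_cball : unit_cube `<=` cball 0 1.
Proof.
by move=> x h; apply/cballP => // i; rewrite mxE; have := h i; lra.
Qed.

(** The translates of [E] by the multiples [(k / K) v], for [k] up to [K], all lie
    in one ball and cover each of its points at most twice, since three of them
    through one point would put three points of [E] on a line.  So [K] times the
    measure of [E] is at most twice that of the ball, for every [K]. *)
Lemma lebesgue_null_of_lines (E : set V) (v : V) (r : R) :
  measurable E -> E `<=` cball 0 r ->
  (forall x (s t : R), 0 < s -> s < t -> E x -> E (x + s *: v) -> E (x + t *: v) ->
    False) ->
  leb E = 0%E.
Proof.
move=> mE Er E3.
pose F K (k : 'I_K.+1) : set V := (fun x => x - (k%:R / K.+1%:R) *: v) @^-1` E.
have mF K k : measurable (F K k).
  by rewrite -[X in measurable X]setTI; exact: measurable_translate.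
have FB K k : F K k `<=` cball 0 (r + `|v|).
  move=> x /Er; rewrite /cball /= !subr0 => xr.
  rewrite -(subrK ((k%:R / K.+1%:R) *: v) x) (le_trans (ler_normD _ _))// lerD//.
  rewrite normrZ ler_piMl// ger0_norm ?divr_ge0//.
  by rewrite ler_pdivrMr// mul1r ler_nat ltnW.
have lF K k : leb (F K k) = leb E by exact: lebesgue_rV_translate.
have F2 K x : (\sum_(k < K.+1) (\1_(F K k) x : R) <= 2 * \1_(cball 0 (r + `|v|)) x).
  have [xB|xB] := pselect (cball 0 (r + `|v|) x); last first.
    rewrite big1 ?mulr_ge0// => k _; rewrite indicE memNset// => /FB; exact: xB.
  rewrite [\1_(cball _ _) x]indicE mem_set// mulr1 -[leRHS]/(2%:R).
  pose A := [set k : 'I_K.+1 | x \in F K k]%SET.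
  have -> : \sum_(k < K.+1) (\1_(F K k) x : R) = #|A|%:R.
    rewrite -sum1_card natr_sum [RHS]big_mkcond /=; apply: eq_bigr => k _.
    by rewrite indicE inE; case: (x \in _).
  rewrite ler_nat leqNgt; apply/negP => /card_gt2P[i [j [k [[Ai Aj Ak] [ij jk ki]]]]].
  have no3 (a b c : 'I_K.+1) : (a < b)%N -> (b < c)%N -> a \in A -> b \in A -> c \in A -> False.
    rewrite !finset.in_set => ab bc /set_mem Aa /set_mem Ab /set_mem Ac.
    apply: (E3 (x - (c%:R / K.+1%:R) *: v) ((c%:R - b%:R) / K.+1%:R)
      ((c%:R - a%:R) / K.+1%:R)) => //.
    - by rewrite divr_gt0// subr_gt0 ltr_nat.
    - by rewrite ltr_pM2r ?invr_gt0// ltrD2l ltrN2 ltr_nat.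
    - by rewrite mulrBl scalerBl addrA subrK.
    - by rewrite mulrBl scalerBl addrA subrK.
  move: ij jk ki; rewrite -!(inj_eq val_inj) /= => ij jk ki.
  have [ij'|ji'] : (i < j)%N \/ (j < i)%N by move: ij; rewrite neq_ltn => /orP.
    have [jk'|kj'] : (j < k)%N \/ (k < j)%N by move: jk; rewrite neq_ltn => /orP.
      exact: (no3 i j k).
    have [ki'|ik'] : (k < i)%N \/ (i < k)%N by move: ki; rewrite neq_ltn => /orP.
      exact: (no3 k i j).
    exact: (no3 i k j).
  have [jk'|kj'] : (j < k)%N \/ (k < j)%N by move: jk; rewrite neq_ltn => /orP.
    have [ki'|ik'] : (k < i)%N \/ (i < k)%N by move: ki; rewrite neq_ltn => /orP.
      exact: (no3 j k i).
    exact: (no3 j i k).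
  exact: (no3 k j i).
have KE K : (K.+1%:R%:E * leb E <= 2%:E * leb (cball 0 (r + `|v|)))%E.
  have -> : (K.+1%:R%:E * leb E = \sum_(k < K.+1) leb (F K k))%E.
    under eq_bigr do rewrite lF.
    rewrite -[leb E]mul1e -[in RHS]ge0_sume_distrl// sumEFin sumr_const card_ord mul1e.
    by [].
  have -> : (\sum_(k < K.+1) leb (F K k) = \int[leb]_x (\sum_(k < K.+1) (\1_(F K k) x)%:E))%E.
    rewrite ge0_integral_sum//; first by apply: eq_bigr => k _; rewrite integral_indic ?setIT//.
    by move=> k; apply/measurable_EFinP; exact: measurable_indic.
  rewrite -(setIT (cball _ _)) -integral_indic//; last exact: measurable_cball.
  rewrite -ge0_integralZl_EFin//; last first.
    by apply/measurable_EFinP/measurable_indic; exact: measurable_cball.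
  apply: ge0_le_integral => //.
  - by move=> x _; rewrite sume_ge0.
  - by apply: emeasurable_sum => k; apply/measurable_EFinP/measurable_indic.
  - by apply: measurable_funeM; apply/measurable_EFinP/measurable_indic; exact: measurable_cball.
  - by move=> x _; rewrite sumEFin -EFinM lee_fin.
have Ef : leb E \is a fin_num.
  rewrite ge0_fin_numE//; apply: le_lt_trans (lebesgue_cball_lty 0 r).
  by apply: le_measure; rewrite ?inE//; exact: measurable_cball.
have Bf : leb (cball 0 (r + `|v|)) \is a fin_num.
  by rewrite ge0_fin_numE//; exact: lebesgue_cball_lty.
apply/eqP; rewrite eq_le measure_ge0 andbT; apply/lee_addgt0Pr => e e0; rewrite add0e.
move: KE; rewrite -(fineK Ef) -(fineK Bf) => KE.
have [K _ Ke] : exists2 K : nat, True & 2 * fine (leb (cball 0 (r + `|v|))) / e < K%:R.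
  by exists (Num.Def.archi_bound (2 * fine (leb (cball 0 (r + `|v|))) / e)) => //; apply: archi_boundP;
   rewrite divr_ge0 ?mulr_ge0 ?fine_ge0// ltW.
have := KE K; rewrite -!EFinM !lee_fin => h.
rewrite -(ler_pM2l (ltr0Sn R K)) (le_trans h)//.
move: Ke; rewrite ltr_pdivrMr// => /ltW/le_trans; apply.
by rewrite ler_pM2r// ler_nat.
Qed.

End balls.

(** * Densities and their interaction *)
Section interaction.
Context {R : realType} {n : nat}.
Local Notation V := 'rV[R]_n.
Local Notation leb := (lebesgue_rV R n).
Implicit Types (g h : V -> R) (k a b : R).

Definition density h := measurable_fun setT h /\ forall x, 0 <= h x.

Definition mass h : \bar R := (\int[leb]_x (h x)%:E)%E.

Definition interaction g h1 h2 : \bar R :=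
  (\int[leb]_x \int[leb]_y (g (x - y) * h1 x * h2 y)%:E)%E.

Definition cutoff h (A : set V) x := h x * \1_A x.

Lemma density_cutoff h (A : set V) : density h -> measurable A -> density (cutoff h A).
Proof.
move=> [mh h0] mA; split; last by move=> x; rewrite mulr_ge0.
by apply: measurable_funM => //; exact: measurable_indic.
Qed.

Lemma densityD h1 h2 : density h1 -> density h2 -> density (fun x => h1 x + h2 x).
Proof.
move=> [m1 p1] [m2 p2]; split; first exact: measurable_funD.
by move=> x; rewrite addr_ge0.
Qed.

Lemma densityZ k h : 0 <= k -> density h -> density (fun x => k * h x).
Proof.
move=> k0 [m1 p1]; split; last by move=> x; rewrite mulr_ge0.
by apply: measurable_funM => //; exact: measurable_cst.
Qed.

Lemma mass_ge0 h : density h -> (0 <= mass h)%E.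
Proof. by move=> [_ h0]; apply: integral_ge0 => x _; rewrite lee_fin. Qed.

Lemma massD h1 h2 : density h1 -> density h2 ->
  mass (fun x => h1 x + h2 x) = (mass h1 + mass h2)%E.
Proof.
move=> [m1 p1] [m2 p2]; rewrite /mass.
under eq_integral do rewrite EFinD.
by rewrite ge0_integralD//; try (by move=> x _; rewrite lee_fin); apply/measurable_EFinP.
Qed.

Lemma massZ k h : 0 <= k -> density h -> mass (fun x => k * h x) = (k%:E * mass h)%E.
Proof.
move=> k0 [m1 p1]; rewrite /mass; under eq_integral do rewrite EFinM.
by rewrite ge0_integralZl_EFin//; [move=> x _; rewrite lee_fin | apply/measurable_EFinP].
Qed.

Lemma le_mass h1 h2 : density h1 -> density h2 -> (forall x, h1 x <= h2 x) ->
  (mass h1 <= mass h2)%E.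
Proof.
move=> [m1 p1] [m2 p2] h12; apply: ge0_le_integral => //.
- by move=> x _; rewrite lee_fin.
- exact/measurable_EFinP.
- exact/measurable_EFinP.
- by move=> x _; rewrite lee_fin.
Qed.

Lemma cutoff_split h (A : set V) : h = (fun x => cutoff h A x + cutoff h (~` A) x).
Proof.
apply/funext => x; rewrite /cutoff -mulrDr -[LHS]mulr1; congr (_ * _).
rewrite !indicE; have [xA|xA] := pselect (A x).
  by rewrite mem_set// memNset ?addr0//; apply.
by rewrite memNset// mem_set ?add0r.
Qed.

Lemma mass_split h (A : set V) : density h -> measurable A ->
  mass h = (mass (cutoff h A) + mass (cutoff h (~` A)))%E.
Proof.
by move=> dh mA; rewrite -massD -?cutoff_split//; apply: density_cutoff => //; exact: measurableC.
Qed.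

Lemma mass_eq0 h : density h -> mass h = 0%E -> {ae leb, forall x, h x = 0}.
Proof.
move=> [mh h0] h00.
have /(ae_eq_integral_abs leb measurableT) : measurable_fun setT (EFin \o h).
  exact/measurable_EFinP.
move=> [+ _]; rewrite (_ : (\int[leb]_x _)%E = 0%E).
  by move=> /(_ erefl); apply: filterS => x /(_ I) [].
by rewrite -[RHS]h00; apply: eq_integral => x _ /=; rewrite ger0_norm.
Qed.

(** The mass as a real number, meaningful when the mass is finite. *)
Definition rmass h : R := fine (mass h).

Lemma rmass_ge0 h : density h -> 0 <= rmass h.
Proof. by move=> dh; rewrite fine_ge0// mass_ge0. Qed.

Lemma rmassE h m : density h -> (mass h <= m%:E)%E -> mass h = (rmass h)%:E.
Proof.
move=> dh hm; rewrite fineK// ge0_fin_numE; first exact: le_lt_trans hm (ltry _).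
exact: mass_ge0.
Qed.

Lemma cutoff_le h A x : density h -> cutoff h A x <= h x.
Proof.
move=> dh; by rewrite /cutoff ler_piMr//; exact: dh.2.
Qed.

Lemma cutoff_neq0 h A x : cutoff h A x != 0 -> A x.
Proof.
rewrite /cutoff indicE; have [/set_mem//|_] := boolP (x \in A).
by rewrite mulr0 eqxx.
Qed.

Lemma rmass_cutoff h A m : density h -> mass h = m%:E -> measurable A ->
  [/\ mass (cutoff h A) = (rmass (cutoff h A))%:E, 0 <= rmass (cutoff h A) <= m &
      m = rmass (cutoff h A) + rmass (cutoff h (~` A))].
Proof.
move=> dh hm mA; have mA' : measurable (~` A) by exact: measurableC.
have e B : measurable B -> mass (cutoff h B) = (rmass (cutoff h B))%:E.
  move=> mB; apply: (@rmassE _ m); first exact: density_cutoff.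
  by rewrite -hm; apply: le_mass => //; [exact: density_cutoff | move=> x; exact: cutoff_le].
have s : m = rmass (cutoff h A) + rmass (cutoff h (~` A)).
  by apply: EFin_inj; rewrite -hm (mass_split dh mA) EFinD !e.
have := rmass_ge0 (density_cutoff dh mA); have := rmass_ge0 (density_cutoff dh mA').
by move=> h1 h2; split => //; [exact: e | apply/andP; split => //; lra].
Qed.

Section kernel.
Variable g : V -> R.
Hypothesis mg : measurable_fun setT g.

Lemma measurable_interaction_kernel h1 h2 : measurable_fun setT h1 -> measurable_fun setT h2 ->
  measurable_fun setT (fun p : V * V => (g (p.1 - p.2) * h1 p.1 * h2 p.2)%:E).
Proof.
move=> m1 m2; apply/measurable_EFinP; apply: measurable_funM.
  apply: measurable_funM.
    exact: (measurableT_comp mg measurable_subrV).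
  exact: (measurableT_comp m1 measurable_fst).
exact: (measurableT_comp m2 measurable_snd).
Qed.

Lemma measurable_interaction_kernel_slice h1 h2 (x : V) : measurable_fun setT h2 ->
  measurable_fun setT (fun y : V => (g (x - y) * h1 x * h2 y)%:E).
Proof.
move=> m2; apply/measurable_EFinP; apply: measurable_funM => //.
apply: measurable_funM; last exact: measurable_cst.
by apply: (measurableT_comp mg); exact: (measurableT_comp measurable_subrV (pair1_measurable x)).
Qed.

Hypothesis g0 : forall x, 0 <= g x.

Lemma interaction_kernel_ge0 h1 h2 x y : density h1 -> density h2 ->
  (0 <= (g (x - y) * h1 x * h2 y)%:E)%E.
Proof. by move=> [_ p1] [_ p2]; rewrite lee_fin !mulr_ge0. Qed.

Lemma measurable_interaction_slice h1 h2 : density h1 -> density h2 ->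
  measurable_fun setT (fun x : V => \int[leb]_y (g (x - y) * h1 x * h2 y)%:E)%E.
Proof.
move=> d1 d2.
apply: (measurable_fun_fubini_tonelli_F (m2 := leb)
  (fun p : V * V => (g (p.1 - p.2) * h1 p.1 * h2 p.2)%:E)).
  exact: measurable_interaction_kernel d1.1 d2.1.
by move=> p; exact: interaction_kernel_ge0.
Qed.

Lemma interaction_ge0 h1 h2 : density h1 -> density h2 -> (0 <= interaction g h1 h2)%E.
Proof.
by move=> d1 d2; apply: integral_ge0 => x _; apply: integral_ge0 => y _; exact: interaction_kernel_ge0.
Qed.

Lemma interactionC (ge : forall x, g (- x) = g x) h1 h2 : density h1 -> density h2 ->
  interaction g h1 h2 = interaction g h2 h1.
Proof.
move=> d1 d2; rewrite /interaction.
rewrite (fubini_tonelli (fun p : V * V => (g (p.1 - p.2) * h1 p.1 * h2 p.2)%:E))/=.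
- apply: eq_integral => x _; apply: eq_integral => y _.
  by rewrite -ge opprB mulrAC.
- exact: measurable_interaction_kernel d1.1 d2.1.
- by move=> p; exact: interaction_kernel_ge0.
Qed.

Lemma interactionDl h1 h2 h : density h1 -> density h2 -> density h ->
  interaction g (fun x => h1 x + h2 x) h = (interaction g h1 h + interaction g h2 h)%E.
Proof.
move=> d1 d2 d; rewrite /interaction -ge0_integralD//.
- apply: eq_integral => x _; rewrite -ge0_integralD//.
  + by apply: eq_integral => y _; rewrite -EFinD mulrDr mulrDl.
  + by move=> y _; exact: interaction_kernel_ge0.
  + exact: measurable_interaction_kernel_slice d.1.
  + by move=> y _; exact: interaction_kernel_ge0.
  + exact: measurable_interaction_kernel_slice d.1.
- by move=> x _; apply: integral_ge0 => y _; exact: interaction_kernel_ge0.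
- exact: measurable_interaction_slice.
- by move=> x _; apply: integral_ge0 => y _; exact: interaction_kernel_ge0.
- exact: measurable_interaction_slice.
Qed.

Lemma interactionZl k h1 h : 0 <= k -> density h1 -> density h ->
  interaction g (fun x => k * h1 x) h = (k%:E * interaction g h1 h)%E.
Proof.
move=> k0 d1 d; rewrite /interaction -ge0_integralZl_EFin//.
- apply: eq_integral => x _; rewrite -ge0_integralZl_EFin//.
  + by apply: eq_integral => y _; rewrite -EFinM; congr EFin; ring.
  + by move=> y _; exact: interaction_kernel_ge0.
  + exact: measurable_interaction_kernel_slice d.1.
- by move=> x _; apply: integral_ge0 => y _; exact: interaction_kernel_ge0.
- exact: measurable_interaction_slice.
Qed.

Definition density_potential (f : V -> R) (x : V) : \bar R := (\int[leb]_y (g (x - y) * f y)%:E)%E.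

Lemma density_potential_ge0 f x : density f -> (0 <= density_potential f x)%E.
Proof. by move=> df; apply: integral_ge0 => y _; rewrite lee_fin mulr_ge0//; exact: df.2. Qed.

Lemma measurable_density_potential f : density f -> measurable_fun setT (density_potential f).
Proof.
move=> df; have d1 : density (fun _ : V => 1 : R) by split.
have := measurable_interaction_slice d1 df.
by apply: eq_measurable_fun => x _; apply: eq_integral => y _; rewrite mulr1.
Qed.

Lemma interaction_potentialE (a f : V -> R) : density a -> density f ->
  interaction g a f = (\int[leb]_x ((a x)%:E * density_potential f x))%E.
Proof.
move=> da df; rewrite {1}/interaction; apply: eq_integral => x _.
rewrite /density_potential -ge0_integralZl_EFin//.
- by apply: eq_integral => y _; rewrite -EFinM mulrA [a x * _]mulrC.
- by move=> y _; rewrite lee_fin mulr_ge0//; exact: df.2.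
- have d1 : density (fun _ : V => 1 : R) by split.
  have := measurable_interaction_kernel_slice (fun=> 1) x df.1.
  by apply: eq_measurable_fun => y _; rewrite mulr1.
- exact: da.2.
Qed.

End kernel.

Lemma le_interaction g g' h1 h1' h2 h2' :
  measurable_fun setT g -> (forall x, 0 <= g x) ->
  measurable_fun setT g' -> (forall x, 0 <= g' x) ->
  density h1 -> density h1' -> density h2 -> density h2' ->
  (forall x y, g (x - y) * h1 x * h2 y <= g' (x - y) * h1' x * h2' y) ->
  (interaction g h1 h2 <= interaction g' h1' h2')%E.
Proof.
move=> mg g0 mg' g0' d1 d1' d2 d2' gg'; apply: ge0_le_integral => //.
- by move=> x _; apply: integral_ge0 => y _; exact: interaction_kernel_ge0.
- exact: measurable_interaction_slice.
- exact: measurable_interaction_slice.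
- move=> x _; apply: ge0_le_integral => //.
  + by move=> y _; exact: interaction_kernel_ge0.
  + exact: measurable_interaction_kernel_slice d2.1.
  + exact: measurable_interaction_kernel_slice d2'.1.
  + by move=> y _; rewrite lee_fin.
Qed.

(** With a constant kernel the interaction is a product of masses; together with
    [le_interaction] this turns pointwise bounds on the kernel into bounds on the
    energy. *)
Lemma interaction_cst k h1 h2 a b : 0 <= k -> density h1 -> density h2 ->
  mass h1 = a%:E -> mass h2 = b%:E ->
  interaction (fun=> k) h1 h2 = (k * a * b)%:E.
Proof.
move=> k0 d1 d2 ma mb; rewrite /interaction.
transitivity (\int[leb]_x ((k * b)%:E * (h1 x)%:E))%E.
  apply: eq_integral => x _.
  transitivity (\int[leb]_y ((k * h1 x)%:E * (h2 y)%:E))%E.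
    by apply: eq_integral => y _; rewrite -EFinM.
  rewrite ge0_integralZl_EFin//.
  - by rewrite -/(mass h2) mb -!EFinM mulrAC.
  - by move=> y _; rewrite lee_fin; exact: d2.2.
  - apply/measurable_EFinP; exact: d2.1.
  - by rewrite mulr_ge0//; exact: d1.2.
rewrite ge0_integralZl_EFin//.
- by rewrite -/(mass h1) ma -!EFinM mulrAC.
- by move=> y _; rewrite lee_fin; exact: d1.2.
- apply/measurable_EFinP; exact: d1.1.
- by rewrite mulr_ge0// -lee_fin -mb mass_ge0.
Qed.

Lemma interaction_le_cst g k h1 h2 a b : measurable_fun setT g -> (forall x, 0 <= g x) ->
  density h1 -> density h2 -> mass h1 = a%:E -> mass h2 = b%:E -> 0 <= k ->
  (forall x y, h1 x != 0 -> h2 y != 0 -> g (x - y) <= k) ->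
  (interaction g h1 h2 <= (k * a * b)%:E)%E.
Proof.
move=> mg g0 d1 d2 ma mb k0 gk.
rewrite -(interaction_cst k0 d1 d2 ma mb); apply: le_interaction => //.
move=> x y; have [->|x0] := eqVneq (h1 x) 0; first by rewrite !mulr0 !mul0r.
have [->|y0] := eqVneq (h2 y) 0; first by rewrite !mulr0.
by rewrite !ler_wpM2r ?gk//; [exact: d2.2|exact: d1.2].
Qed.

Lemma interaction_ge_cst g k h1 h2 a b : measurable_fun setT g -> (forall x, 0 <= g x) ->
  density h1 -> density h2 -> mass h1 = a%:E -> mass h2 = b%:E -> 0 <= k ->
  (forall x y, h1 x != 0 -> h2 y != 0 -> k <= g (x - y)) ->
  ((k * a * b)%:E <= interaction g h1 h2)%E.
Proof.
move=> mg g0 d1 d2 ma mb k0 gk.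
rewrite -(interaction_cst k0 d1 d2 ma mb); apply: le_interaction => //.
move=> x y; have [->|x0] := eqVneq (h1 x) 0; first by rewrite !mulr0 !mul0r.
have [->|y0] := eqVneq (h2 y) 0; first by rewrite !mulr0.
by rewrite !ler_wpM2r ?gk//; [exact: d2.2|exact: d1.2].
Qed.

End interaction.

(** * Competitors and reduction to nonnegative kernels *)
Section bounds.
Context {R : realType} {n : nat}.
Local Notation V := 'rV[R]_n.

Lemma continuous_bounded_cball (f : V -> R) (c : V) (r : R) : continuous f ->
  exists2 S, 0 <= S & forall x, cball c r x -> `|f x| <= S.
Proof.
move=> cf; have : compact (f @` cball c r).
  apply: continuous_compact; last exact: compact_cball.
  exact: continuous_subspaceT.
move/compact_bounded => [M [_ MP]].
exists (`|M| + 1); first by rewrite addr_ge0.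
by move=> x cx; apply: MP; [rewrite (le_lt_trans (ler_norm M))// ltrDl | exists x].
Qed.

Lemma norm_le_enorm (x : V) : `|x| <= enorm x.
Proof.
apply: normrV_le => [|i]; first exact: sqrtr_ge0.
rewrite /enorm -sqrtr_sqr ler_wsqrtr// (bigD1 i)//= lerDl sumr_ge0// => j _.
exact: sqr_ge0.
Qed.

Lemma diverges_sup_norm (g : V -> R) : diverges_at_infinity g ->
  forall M, exists2 r, 0 <= r & forall x, r <= `|x| -> M <= g x.
Proof.
move=> gd M; have [r rP] := gd M; exists `|r| => // x rx; apply: rP.
by rewrite (le_trans (ler_norm r))// (le_trans rx)// norm_le_enorm.
Qed.

Lemma diverges_bounded_below (g : V -> R) : continuous g -> diverges_at_infinity g ->
  exists2 c, 0 <= c & forall x, 0 <= g x + c.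
Proof.
move=> cg gd; have [r r0 rP] := diverges_sup_norm gd 0.
have [S S0 SP] := continuous_bounded_cball 0 r cg.
exists S => // x; have [xr|rx] := leP `|x| r.
  have := SP x; rewrite /cball /= subr0 ler_norml => /(_ xr)/andP[+ _].
  by rewrite lerNl -subr_ge0 opprK addrC.
by rewrite addr_ge0// rP// ltW.
Qed.

End bounds.

Section integral_lemmas.
Context {R : realType} {d} {T : measurableType d}.

(** Here [u] may have an infinite integral.  Both sides of
    [D^+ + w = D^- + u], with [D = u - w], are sums of nonnegative functions, and
    [D^-] is integrable because it is at most [w]. *)
Lemma integral_subr (mu : {measure set T -> \bar R}) (u : T -> \bar R) (w : T -> R) (k : R) :
  measurable_fun setT u -> (forall x, (0 <= u x)%E) ->
  measurable_fun setT w -> (forall x, 0 <= w x) ->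
  (\int[mu]_x (w x)%:E = k%:E)%E ->
  (\int[mu]_x (u x - (w x)%:E) + k%:E = \int[mu]_x u x)%E.
Proof.
move=> mu_ u0 mw w0 wk.
have mwE : measurable_fun setT (EFin \o w) by exact/measurable_EFinP.
pose D x := (u x - (w x)%:E)%E.
have mD : measurable_fun setT D by apply: emeasurable_funB.
have mDp : measurable_fun setT (D^\+)%E by exact: measurable_funepos.
have mDn : measurable_fun setT (D^\-)%E by exact: measurable_funeneg.
have Dnw x : (D^\- x <= (w x)%:E)%E.
  rewrite funenegE /D; move: (u x) (u0 x) => [z||]//= z0; last by rewrite maxNye lee_fin.
  by rewrite -?EFinB -?EFinN -EFin_max lee_fin ge_max w0 andbT; move: z0; rewrite lee_fin; lra.
have key x :  (D^\+ x + (w x)%:E = D^\- x + u x)%E.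
  rewrite funeposE funenegE /D; move: (u x) (u0 x) => [z||]//= z0.
    rewrite -?EFinB -?EFinN -!EFin_max -?EFinD; congr EFin.
    by rewrite !maxEle; case: ifPn; case: ifPn; rewrite -?ltNge; lra.
  by rewrite ?addye//= ?maxye ?maxNye add0e.
have Ikey : (\int[mu]_x D^\+ x + k%:E = \int[mu]_x D^\- x + \int[mu]_x u x)%E.
  rewrite -wk -!ge0_integralD//.
    by apply: eq_integral => x _; exact: key.
  by move=> x _; rewrite lee_fin.
have qfin : (\int[mu]_x D^\- x)%E \is a fin_num.
  rewrite ge0_fin_numE; last by apply: integral_ge0 => x _; exact: funeneg_ge0.
  rewrite (le_lt_trans _ (ltry k))// -wk; apply: ge0_le_integral => //.
have DE : (\int[mu]_x D x = \int[mu]_x D^\+ x - \int[mu]_x D^\- x)%E by exact: integralE.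
rewrite -[X in (X + _)%E]/(\int[mu]_x D x)%E DE.
move: Ikey qfin.
case: (\int[mu]_x D^\+ x)%E (\int[mu]_x D^\- x)%E (\int[mu]_x u x)%E => [a||] [q||] [b||] //=.
by rewrite -?EFinB -!EFinD => -[h] _; congr EFin; lra.
Qed.

End integral_lemmas.

Section slices.
Context {R : realType} {d1 d2} {T1 : measurableType d1} {T2 : measurableType d2}.

(** Tonelli's measurability statement for a signed integrand, by positive and
    negative parts. *)
Lemma measurable_integral_slice (mu : {sigma_finite_measure set T2 -> \bar R})
  (F : T1 * T2 -> \bar R) : measurable_fun setT F ->
  measurable_fun setT (fun x => \int[mu]_y F (x, y))%E.
Proof.
move=> mF.
have -> : (fun x => \int[mu]_y F (x, y))%E =
    (fun x => \int[mu]_y (F^\+ (x, y)) - \int[mu]_y (F^\- (x, y)))%E.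
  apply/funext => x; rewrite [LHS]integralE.
  by congr (_ - _)%E; apply: eq_integral => y _; rewrite ?funeposE ?funenegE.
apply: emeasurable_funB.
- by apply: (measurable_fun_fubini_tonelli_F (m2 := mu) (F^\+)%E) => //; exact: measurable_funepos.
- by apply: (measurable_fun_fubini_tonelli_F (m2 := mu) (F^\-)%E) => //; exact: measurable_funeneg.
Qed.

End slices.

Section minimizers.
Context {R : realType} {n : nat}.
Local Notation V := 'rV[R]_n.
Local Notation leb := (lebesgue_rV R n).
Implicit Types (g h f : V -> R) (m c : R).

Definition competitor m h := [/\ density h, forall x, h x <= 1 & mass h = m%:E].

(** [optimal] is [minimizer] with everywhere defined constraints, which spare the
    later arguments any choice of representative. *)
Definition optimal g m f := competitor m f /\
  forall h, competitor m h -> (interaction g f f <= interaction g h h)%E.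

Lemma competitor_admissible m h : competitor m h -> admissible m h.
Proof.
move=> [[mh h0] h1 hm].
have nE : (\int[leb]_x `|(h x)%:E| = m%:E)%E.
  by rewrite -hm; apply: eq_integral => x _ /=; rewrite ger0_norm.
split.
- by apply/integrableP; split; [exact/measurable_EFinP|rewrite nE ltry].
- by apply: nearW => x; rewrite h0 h1.
- by rewrite Lnorm1.
Qed.

Lemma admissible_competitor m f : admissible m f ->
  exists2 f', competitor m f' & {ae leb, forall x, f x = f' x}.
Proof.
move=> [/integrableP[/measurable_EFinP mf _] f01 fm].
pose f' x := Num.max 0 (Num.min 1 (f x)).
have ff' : {ae leb, forall x, f x = f' x}.
  apply: filterS f01 => x /andP[x0 x1].
  by rewrite /f' min_r// max_r.
exists f' => //; have mf' : measurable_fun setT f'.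
  apply: measurable_maxr; first exact: measurable_cst.
  by apply: measurable_minr => //; exact: measurable_cst.
split.
- by split=> // x; rewrite le_max lexx.
- by move=> x; rewrite ge_max ler01 ge_min lexx.
- rewrite -fm Lnorm1; apply: ae_eq_integral => //.
  + exact/measurable_EFinP.
  + by apply: measurableT_comp => //; exact/measurable_EFinP.
  + apply: filterS2 f01 ff' => x /andP[x0 _] <- _ /=.
    by rewrite ger0_norm.
Qed.

Lemma density_energy_ae g f f' : measurable_fun setT g -> measurable_fun setT f ->
  measurable_fun setT f' -> {ae leb, forall x, f x = f' x} ->
  density_energy g f = density_energy g f'.
Proof.
move=> mg mf mf' ff'.
apply: ae_eq_integral => //.
- exact: (measurable_integral_slice leb (measurable_interaction_kernel mg mf mf)).
- exact: (measurable_integral_slice leb (measurable_interaction_kernel mg mf' mf')).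
apply: filterS (ff') => x fx _; apply: ae_eq_integral => //.
- exact: measurable_interaction_kernel_slice.
- exact: measurable_interaction_kernel_slice.
by apply: filterS (ff') => y fy _; rewrite fx fy.
Qed.

(** The kernel [c] alone has energy [c * m * m] on every competitor, so the
    minimizers do not change when [g] is replaced by [g + c]. *)
Lemma density_energy_shift g c m h : measurable_fun setT g -> 0 <= c ->
  (forall x, 0 <= g x + c) -> competitor m h ->
  (density_energy g h + (c * m * m)%:E = interaction (fun x => (g x + c)%R) h h)%E.
Proof.
move=> mg c0 gc0 [dh h1 hm].
have mgc : measurable_fun setT (fun x => g x + c) by exact: measurable_funD.
rewrite /density_energy /interaction.
rewrite -(@integral_subr _ _ _ leb (fun x => \int[leb]_y ((g (x - y) + c)%R * h x * h y)%:E)%E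
  (fun x => c * m * h x) (c * m * m)); last 5 first.
- exact: (measurable_interaction_slice mgc gc0 dh dh).
- by move=> x; apply: integral_ge0 => y _; exact: (interaction_kernel_ge0 gc0 x y dh dh).
- by apply: measurable_funM => //; exact: dh.1.
- move=> x; rewrite !mulr_ge0//; last exact: dh.2.
  by rewrite -lee_fin -hm mass_ge0.
- have m0 : 0 <= m by rewrite -lee_fin -hm mass_ge0.
  by have := @massZ _ _ (c * m) h (mulr_ge0 c0 m0) dh; rewrite hm.
congr (_ + _)%E; apply: eq_integral => x _.
have <- := @integral_subr _ _ _ leb (fun y => ((g (x - y) + c)%R * h x * h y)%:E)%E
  (fun y => c * h x * h y) (c * m * h x); last 5 first.
- exact: (measurable_interaction_kernel_slice mgc h x dh.1).
- by move=> y; exact: (interaction_kernel_ge0 gc0 x y dh dh).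
- by apply: measurable_funM => //; exact: dh.1.
- by move=> y; rewrite !mulr_ge0//; exact: dh.2.
- have := @massZ _ _ (c * h x) h (mulr_ge0 c0 (dh.2 x)) dh.
  by rewrite hm -EFinM mulrAC.
rewrite -addeA subee// adde0; apply: eq_integral => y _.
by rewrite -EFinB; congr EFin; ring.
Qed.

#[local] Opaque interaction density_energy.

Lemma minimizer_optimal g c m f : continuous g -> 0 <= c ->
  (forall x, 0 <= g x + c) -> minimizer g m f ->
  exists2 f', optimal (fun x => g x + c) m f' & {ae leb, forall x, f x = f' x}.
Proof.
move=> cg c0 gc0 [fadm fmin].
have mg := continuous_measurable_rV cg.
have [f' f'c ff'] := admissible_competitor fadm.
exists f' => //; split => // h hc.
rewrite -!(@density_energy_shift _ _ m)// leeD2r//.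
rewrite -(@density_energy_ae g f f')//.
- by apply: fmin; exact: competitor_admissible.
- by have [/integrableP[/measurable_EFinP]] := fadm.
- by case: f'c => -[].
Qed.

End minimizers.

(** * Localization of the mass of minimizers *)
Section exchange.
Context {R : realType} {n : nat}.
Local Notation V := 'rV[R]_n.
Local Notation leb := (lebesgue_rV R n).
Variable g : V -> R.
Hypothesis mg : measurable_fun setT g.
Hypothesis g0 : forall x, 0 <= g x.
Hypothesis ge : forall x, g (- x) = g x.
Local Notation W := (interaction g).
Implicit Types (h f p a b : V -> R).

Lemma interactionDr h h1 h2 : density h -> density h1 -> density h2 ->
  W h (fun x => h1 x + h2 x) = (W h h1 + W h h2)%E.
Proof.
move=> dh d1 d2; have d12 := densityD d1 d2.
by rewrite !(interactionC mg g0 ge dh)// interactionDl.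
Qed.

Lemma interaction_square p a : density p -> density a ->
  W (fun x => p x + a x) (fun x => p x + a x) = (W p p + (W p a + W p a + W a a))%E.
Proof.
move=> dp da; have dpa := densityD dp da.
rewrite interactionDl// !interactionDr// (interactionC mg g0 ge da dp).
have addE (x y z t : \bar R) : (x + y + (z + t) = x + (y + z + t))%E by rewrite !addeA.
exact: addE.
Qed.

(** Minimality tested on the replacement of the part [a] of [f] by [b]; the finite
    self-energy of the common part [p] cancels. *)
Lemma optimal_exchange m f p a b : optimal g m f -> (W f f < +oo)%E ->
  f = (fun x => p x + a x) -> density p -> density a -> density b ->
  (forall x, p x + b x <= 1) -> mass a = mass b ->
  (W p a + W p a + W a a <= W p b + W p b + W b b)%E.
Proof.
move=> [[df f1 fm] fmin] Wf fpa dp da db pb1 mab.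
have : (W f f <= W (fun x => p x + b x)%R (fun x => p x + b x)%R)%E.
  apply: fmin; split => //; first exact: densityD.
  by rewrite massD// -mab -massD// -fpa.
have WfE : W f f = (W p p + (W p a + W p a + W a a))%E.
  by rewrite fpa; exact: interaction_square.
rewrite (interaction_square dp db) WfE leeD2lE// ge0_fin_numE; last exact: interaction_ge0.
apply: le_lt_trans Wf; rewrite WfE leeDl//.
by apply: adde_ge0; [apply: adde_ge0|]; exact: interaction_ge0.
Qed.

(** A competitor for the mass [b] is one for the mass [m <= b] after
    multiplication by [m / b <= 1], and the energy is quadratic. *)
Lemma optimal_scale m f (b : R) h : optimal g m f -> 0 < b -> m <= b ->
  density h -> (forall x, h x <= 1) -> mass h = b%:E ->
  (W f f <= ((m / b) ^+ 2)%:E * W h h)%E.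
Proof.
move=> [[df f1 fm] fmin] b0 mb dh h1 hb.
have m0 : 0 <= m by rewrite -lee_fin -fm mass_ge0.
have mb0 : 0 <= m / b by rewrite divr_ge0// ltW.
have dk : density (fun x => m / b * h x) by exact: densityZ.
have -> : (((m / b) ^+ 2)%:E * W h h)%E = W (fun x => m / b * h x)%R (fun x => m / b * h x)%R.
  rewrite (interactionZl mg g0 mb0 dh dk) (interactionC mg g0 ge dh dk).
  by rewrite (interactionZl mg g0 mb0 dh dh) muleA -EFinM -expr2.
apply: fmin; split => //.
- move=> x; rewrite mulr_ile1//; first exact: dh.2.
  by rewrite ler_pdivrMr// mul1r.
- by rewrite massZ// hb -EFinM divfK// gt_eqF.
Qed.

End exchange.

Section concentration.
Context {R : realType} {n : nat}.
Local Notation V := 'rV[R]_n.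
Local Notation leb := (lebesgue_rV R n).
Variable g : V -> R.
Hypothesis cg : continuous g.
Hypothesis g0 : forall x, 0 <= g x.
Hypothesis ge : forall x, g (- x) = g x.
Hypothesis gdiv : forall M, exists2 r, 0 <= r & forall x, r <= `|x| -> M <= g x.
Local Notation W := (interaction g).
Variables (m : nat -> R) (f : nat -> V -> R).
Hypothesis m0 : forall j, 0 < m j.
Hypothesis m_ni : nonincreasing_seq m.
Hypothesis m_cvg : m @ \oo --> 0.
Hypothesis fopt : forall j, optimal g (m j) (f j).

Let mg : measurable_fun setT g := continuous_measurable_rV cg.
Let df j : density (f j). Proof. by have [[]] := fopt j. Qed.
Let f1 j x : f j x <= 1. Proof. by have [[]] := fopt j. Qed.
Let fm j : mass (f j) = (m j)%:E. Proof. by have [[]] := fopt j. Qed.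

Lemma optimal_energy_lty j : m j <= 1 -> (W (f j) (f j) < +oo)%E.
Proof.
move=> mj1; pose q : V -> R := \1_unit_cube.
have dq : density q.
  by split=> //; apply: measurable_indic; exact: measurable_unit_cube.
have mq : mass q = 1%:E.
  rewrite /mass integral_indic ?setIT//; last exact: measurable_unit_cube.
  exact: lebesgue_unit_cube.
have [S S0 SP] := continuous_bounded_cball 0 2 cg.
have Wq : (W q q <= (S * 1 * 1)%:E)%E.
  apply: interaction_le_cst => // x y; rewrite /q !indicE.
  have [/set_mem/unit_cube_cball xq|] := boolP (x \in unit_cube); last by rewrite eqxx.
  have [/set_mem/unit_cube_cball yq|] := boolP (y \in unit_cube); last by rewrite eqxx.
  by move=> _ _; apply: le_trans (ler_norm _) (SP _ (cball0_subr xq yq _)).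
apply: le_lt_trans (optimal_scale mg g0 ge (fopt j) ltr01 mj1 dq _ mq) _.
  by move=> x; rewrite /q indicE lern1; case: (_ \in _).
rewrite lte_mul_pinfty//; first by rewrite lee_fin sqr_ge0.
exact: le_lt_trans Wq (ltry _).
Qed.

Let e j : R := fine (W (f j) (f j)) / m j ^+ 2.
Let eE j : m j <= 1 -> W (f j) (f j) = (e j * m j ^+ 2)%:E.
Proof.
move=> mj1; rewrite /e divfK ?sqrf_eq0 ?gt_eqF// fineK//.
by rewrite ge0_fin_numE ?interaction_ge0//; exact: optimal_energy_lty.
Qed.

Let A := [set e j | j in [set j | m j <= 1]].
Let einf := inf A.

Let mnear (s : R) : 0 < s -> \forall j \near \oo, m j <= s.
Proof. by move=> s0; apply: filterS (cvgr0_near_lt m_cvg s0) => j; exact: ltW. Qed.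

Let hasinf : has_inf A.
Proof.
split.
  by have [j _ /(_ j (leqnn j)) mj] := mnear ltr01; exists (e j), j.
exists 0 => _ [j _ <-]; rewrite /e divr_ge0 ?sqr_ge0// fine_ge0//.
exact: interaction_ge0.
Qed.

Let einf_ge0 : 0 <= einf.
Proof.
apply: lb_le_inf; first exact: hasinf.1.
move=> _ [j _ <-]; rewrite /e divr_ge0 ?sqr_ge0// fine_ge0//.
exact: interaction_ge0.
Qed.

Let einf_lower h b : density h -> (forall x, h x <= 1) -> 0 < b -> mass h = b%:E ->
  ((b ^+ 2 * einf)%:E <= W h h)%E.
Proof.
move=> dh h1 b0 hb.
have [k [mk1 mkb]] : exists k, m k <= 1 /\ m k <= b.
  have [k _ kP] : \forall j \near \oo, m j <= Num.min 1 b.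
    by apply: mnear; rewrite lt_min ltr01.
  by exists k; have := kP k (leqnn k); rewrite le_min => /andP.
have ek : einf <= e k by apply: ge_inf; [exact: hasinf.2 | exists k].
have := optimal_scale mg g0 ge (fopt k) b0 mkb dh h1 hb.
rewrite eE//; move: (interaction_ge0 g0 dh dh).
case: (W h h) => [w||]//; rewrite ?leey// => w0.
rewrite -EFinM !lee_fin => hw.
have mk2 : 0 < m k ^+ 2 by rewrite exprn_gt0.
have {hw} : e k <= w / b ^+ 2.
  by rewrite -(ler_pM2r mk2) (le_trans hw)// expr_div_n mulrAC -mulrA mulrC mulrA.
rewrite ler_pdivlMr ?exprn_gt0// => hw.
by rewrite (le_trans _ hw)// mulrC ler_wpM2r// exprn_ge0// ltW.
Qed.

(** Let [t] be the fraction of the mass outside the ball of radius [R1].  The part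
    inside has energy at least [(1 - t) ^ 2 * einf], in units of [m j ^ 2], and
    the interaction between the two parts is at least [M * t], because half of
    the mass lies at distance at least [r] from the part outside.  As
    [M = 2 * einf + 1], this gives [t <= e j - einf]. *)
Lemma mass_loss_vanishes (R0 : R) :
  (\forall j \near \oo, m j / 2 <= rmass (cutoff (f j) (cball 0 R0))) ->
  exists2 R1, R0 <= R1 & forall d, 0 < d ->
  \forall j \near \oo, rmass (cutoff (f j) (~` cball 0 R1)) <= d * m j.
Proof.
move=> tight; pose M := 2 * einf + 1.
have M0 : 0 <= M by rewrite addr_ge0// mulr_ge0.
have [r r0 rP] := gdiv M.
exists (R0 + r); first by rewrite lerDl.
move=> d d0.
(* [e] is nonincreasing along the sequence, so being within [d] of its infimum
   once is being so from then on. *)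
have [_ [j1 /= mj1 <-] ej1] : exists2 x, A x & x < einf + d.
  by apply: inf_adherent.
near=> j.
have jj1 : (j1 <= j)%N by near: j; exact: nbhs_infty_ge.
have mjj1 : m j <= m j1 by exact: m_ni.
have mj : m j <= 1 by exact: le_trans mjj1 mj1.
have ej : e j < einf + d.
  apply: le_lt_trans ej1.
  have := optimal_scale mg g0 ge (fopt j) (m0 j1) mjj1 (df j1) (f1 j1) (fm j1).
  rewrite !eE// -EFinM lee_fin expr_div_n.
  have -> : m j ^+ 2 / m j1 ^+ 2 * (e j1 * m j1 ^+ 2) = e j1 * m j ^+ 2.
    by field; rewrite gt_eqF.
  by rewrite ler_pM2r// exprn_gt0.
have tj : m j / 2 <= rmass (cutoff (f j) (cball 0 R0)) by near: j.
have mB1 := measurable_cball (0 : V) (R0 + r).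
have mB0 := measurable_cball (0 : V) R0.
have mC1 : measurable (~` cball (0 : V) (R0 + r)) by exact: measurableC.
set p := cutoff (f j) (cball 0 (R0 + r)); set a := cutoff (f j) (~` cball 0 (R0 + r)).
set q := cutoff (f j) (cball 0 R0).
have dp : density p by exact: density_cutoff.
have da : density a by exact: density_cutoff.
have dq : density q by exact: density_cutoff.
have [pE /andP[p0 pm] pa] := rmass_cutoff (df j) (fm j) mB1.
have [aE /andP[a0 am] _] := rmass_cutoff (df j) (fm j) mC1.
have [qE /andP[q0 qm] _] := rmass_cutoff (df j) (fm j) mB0.
rewrite -/p -/a -/q in pE p0 pm pa aE a0 am qE q0 qm tj *.
have qp x : q x <= p x.
  rewrite /q /p /cutoff ler_wpM2l//; first exact: (df j).2.
  rewrite !indicE ler_nat; have [/set_mem xq|] := boolP (x \in cball 0 R0); last by [].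
  by rewrite mem_set// /cball /=; apply: le_trans xq _; rewrite lerDl.
have rqp : rmass q <= rmass p by rewrite -lee_fin -pE -qE; exact: le_mass.
have mj0 := m0 j.
have p_gt0 : 0 < rmass p by rewrite (lt_le_trans _ rqp)// (lt_le_trans _ tj)// divr_gt0.
have Wqa : ((M * rmass q * rmass a)%:E <= W q a)%E.
  apply: interaction_ge_cst => // x y /cutoff_neq0 xq /cutoff_neq0 ya.
  by apply: rP; exact: cball0_far xq ya.
have Wpa : (W q a <= W p a)%E.
  apply: le_interaction => // x y.
  by rewrite ler_wpM2r//; [exact: da.2 | rewrite ler_wpM2l].
have Wpp := einf_lower dp (fun x => le_trans (cutoff_le _ x (df j)) (f1 j x)) p_gt0 pE.
have : ((rmass p ^+ 2 * einf + (M * rmass q * rmass a + M * rmass q * rmass a))%:E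
    <= (e j * m j ^+ 2)%:E)%E.
  rewrite -(eE mj) (etrans (congr1 (fun h => W h h) (cutoff_split (f j) (cball 0 (R0 + r))))
    (interaction_square mg g0 ge dp da)).
  rewrite EFinD; apply: leeD => //.
  rewrite -[X in (X <= _)%E]adde0; apply: leeD; last exact: interaction_ge0.
  by rewrite EFinD; apply: leeD; exact: le_trans Wqa Wpa.
rewrite lee_fin => key.
have {key} : rmass p ^+ 2 * einf + M * m j * rmass a <= (einf + d) * m j ^+ 2.
  apply: (@le_trans _ _ (e j * m j ^+ 2)); last first.
    by rewrite ler_wpM2r ?sqr_ge0// ltW.
  apply: le_trans key; rewrite lerD2l -mulrDl ler_wpM2r// -mulrDr ler_wpM2l//; lra.
have -> : rmass p = m j - rmass a by lra.
rewrite /M => key.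
rewrite -(ler_pM2r mj0).
have sq : 0 <= rmass a ^+ 2 * einf by rewrite mulr_ge0// sqr_ge0.
lra.
Unshelve. all: by end_near. Qed.

End concentration.

Section compact_support.
Context {R : realType} {n : nat}.

(** The comparison of costs behind [optimal_no_escape], where [a] and [q] are the
    masses outside the large and the small ball. *)
Let escape_costs (S1 S2 m q a : R) : 0 <= S1 -> 0 <= S2 -> 0 < m -> 0 <= q -> 0 < a ->
  a <= q -> (2 * S2 + S1 + 2) * q <= m ->
  (2 * S1 + 2) * (m - q) * a + (2 * S1 + 2) * (m - q) * a <=
    S1 * m * a + S2 * q * a + (S1 * m * a + S2 * q * a) + S1 * a * a -> False.
Proof.
move=> S10 S20 m0 q0 a0 aq loss h.
have {}h : 2 * (2 * S1 + 2) * (m - q) <= 2 * (S1 * m + S2 * q) + S1 * a.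
  by rewrite -(ler_pM2r a0); lra.
have aq1 : S1 * a <= S1 * q by rewrite ler_wpM2l.
have h1 : 0 <= S1 * q by rewrite mulr_ge0.
have h2 : 0 <= S2 * q by rewrite mulr_ge0.
have h3 : S1 * (2 * q) <= S1 * m by rewrite ler_wpM2l//; lra.
lra.
Qed.

Local Notation V := 'rV[R]_n.
Local Notation leb := (lebesgue_rV R n).
Variable g : V -> R.
Hypothesis cg : continuous g.
Hypothesis g0 : forall x, 0 <= g x.
Hypothesis ge : forall x, g (- x) = g x.
Hypothesis gdiv : forall M, exists2 r, 0 <= r & forall x, r <= `|x| -> M <= g x.
Local Notation W := (interaction g).
Let mg : measurable_fun setT g := continuous_measurable_rV cg.

(** The part [a] of [f] outside the ball of radius [R2] is replaced by a multiple
    [b] of [1 - f] on the unit cube, which fits below the constraint since the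
    cube has volume one and [m <= 1 / 2].  The interaction of [b] with the bulk
    is at most [S1] per unit of mass, and that of [a] is about [M], which exceeds
    [2 * S1].  The constant [S2] is harmless although it depends on [R2]: it is
    multiplied by the fraction of mass outside the ball of radius [R1], at most
    [1 / K]. *)
Lemma optimal_no_escape (R1 : R) : 0 <= R1 ->
  exists R2, R1 <= R2 /\ exists2 d, 0 < d & forall m f, 0 < m -> m <= 2^-1 ->
    optimal g m f -> rmass (cutoff f (~` cball 0 R1)) <= d * m ->
    mass (cutoff f (~` cball 0 R2)) = 0%E.
Proof.
move=> R10.
have [S1 S10 S1P] := continuous_bounded_cball 0 (R1 + 2) cg.
pose M := 2 * S1 + 2.
have M0 : 0 <= M by rewrite addr_ge0// mulr_ge0.
have [r r0 rP] := gdiv M.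
pose R2 := R1 + r.
have [S2 S20 S2P] := continuous_bounded_cball 0 (R2 + 1) cg.
pose K := 2 * S2 + S1 + 2.
have K0 : 0 < K by rewrite /K; lra.
exists R2; split; first by rewrite lerDl.
exists K^-1; first by rewrite invr_gt0.
move=> m f m0 m2 fopt loss.
have [[df f1 fm] _] := fopt.
have mB1 := measurable_cball (0 : V) R1.
have mB2 := measurable_cball (0 : V) R2.
have mC1 : measurable (~` cball (0 : V) R1) by exact: measurableC.
have mC2 : measurable (~` cball (0 : V) R2) by exact: measurableC.
have mQ := @measurable_unit_cube R n.
set p := cutoff f (cball 0 R2); set a := cutoff f (~` cball 0 R2).
have dp : density p by exact: density_cutoff.
have da : density a by exact: density_cutoff.
have [_ /andP[_ pm] _] := rmass_cutoff df fm mB2.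
have [aE /andP[a0 am] _] := rmass_cutoff df fm mC2.
have [q1E /andP[q10 q1m] q1s] := rmass_cutoff df fm mB1.
have [q2E /andP[q20 q2m] _] := rmass_cutoff df fm mC1.
rewrite -/p -/a in pm aE a0 am *.
set q1 := cutoff f (cball 0 R1) in q1E q10 q1m q1s *.
set q2 := cutoff f (~` cball 0 R1) in q2E q20 q2m q1s loss *.
have dq1 : density q1 by exact: density_cutoff.
have dq2 : density q2 by exact: density_cutoff.
have aq2 : rmass a <= rmass q2.
  rewrite -lee_fin -aE -q2E; apply: le_mass => // x.
  rewrite /a /q2 /cutoff ler_wpM2l//; first exact: df.2.
  rewrite !indicE ler_nat; have [/set_mem xC|] := boolP (x \in ~` cball 0 R2); last by [].
  by rewrite mem_set// /cball /= => xB; apply: xC; apply: le_trans xB _; rewrite lerDl.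
have [a_eq0|a_neq0] := eqVneq (rmass a) 0; first by rewrite aE a_eq0.
have a_gt0 : 0 < rmass a by rewrite lt_def a_neq0.
exfalso.
pose u x := (1 - f x) * \1_(@unit_cube R n) x.
have du : density u.
  apply: (@density_cutoff _ _ (fun x => 1 - f x)) => //; split.
    by apply: measurable_funB => //; exact: df.1.
  by move=> x; rewrite subr_ge0.
have d1Q : density (\1_(@unit_cube R n) : V -> R).
  by split => //; exact: measurable_indic.
have m1Q : mass (\1_(@unit_cube R n) : V -> R) = 1%:E.
  rewrite /mass integral_indic ?setIT//; exact: lebesgue_unit_cube.
have [fqE /andP[fq0 fqm] _] := rmass_cutoff df fm mQ.
have dfq : density (cutoff f (@unit_cube R n)) by exact: density_cutoff.
have uE1 : (mass u + mass (cutoff f (@unit_cube R n)))%E = 1%:E.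
  rewrite -massD// -m1Q; congr mass; apply/funext => x; rewrite /u /cutoff.
  by rewrite -mulrDl subrK mul1r.
have uE : mass u = (rmass u)%:E.
  by apply: (@rmassE _ _ _ 1) => //; rewrite -uE1 leeDl// mass_ge0.
move: uE1; rewrite uE fqE -EFinD => -[uE1].
have u_gt0 : 0 < rmass u by lra.
pose t := rmass a / rmass u.
have t0 : 0 <= t by rewrite divr_ge0// ltW.
have t1 : t <= 1 by rewrite ler_pdivrMr// mul1r; lra.
pose b x := t * u x.
have db : density b by exact: densityZ.
have bE : mass b = (rmass a)%:E.
  by rewrite massZ// uE -EFinM divfK// gt_eqF.
have bQ x : b x != 0 -> cball 0 1 x.
  rewrite /b /u indicE; have [/set_mem/unit_cube_cball//|_] := boolP (x \in unit_cube).
  by rewrite !mulr0 eqxx.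
have f0 := df.2.
have ple x : p x <= f x by exact: cutoff_le.
have pb1 x : p x + b x <= 1.
  have bx : b x <= 1 - f x.
    have fx : 0 <= 1 - f x by rewrite subr_ge0.
    rewrite /b -[leRHS]mul1r ler_pM//; first exact: du.2.
    by rewrite /u ler_piMr// indicE lern1; case: (_ \in _).
  by rewrite -(subrK (f x) 1) addrC lerD.
have m1 : m <= 1 by lra.
have Wf : (W f f < +oo)%E.
  exact: (@optimal_energy_lty _ _ _ cg g0 ge (fun=> m) (fun=> f) (fun=> fopt) 0%N).
have key := optimal_exchange mg g0 ge fopt Wf (cutoff_split f (cball 0 R2)) dp da db pb1
  (etrans aE (esym bE)).
have Wpa : ((M * rmass q1 * rmass a)%:E <= W p a)%E.
  apply: (@le_trans _ _ (W q1 a)).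
    apply: interaction_ge_cst => // x y /cutoff_neq0 xq /cutoff_neq0 ya.
    by apply: rP; exact: cball0_far xq ya.
  apply: le_interaction => // x y.
  rewrite ler_wpM2r//; first exact: da.2.
  rewrite ler_wpM2l// /q1 /p /cutoff ler_wpM2l//.
  rewrite !indicE ler_nat; have [/set_mem xB|] := boolP (x \in cball 0 R1); last by [].
  by rewrite mem_set//; apply: le_trans xB _; rewrite lerDl.
have d1 : density (cutoff p (cball 0 R1)) by exact: density_cutoff.
have d2 : density (cutoff p (~` cball 0 R1)) by exact: density_cutoff.
have gS1 x y : cball 0 R1 x -> b y != 0 -> g (x - y) <= S1.
  move=> xB /bQ yQ; apply: le_trans (ler_norm _) (S1P _ (cball0_subr xB yQ _)).
  by rewrite lerD2l ler1n.
have pE B : measurable B -> mass (cutoff p B) = (rmass (cutoff p B))%:E /\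
    rmass (cutoff p B) <= rmass (cutoff f B).
  move=> mB; have [fE _ _] := rmass_cutoff df fm mB.
  have dpB : density (cutoff p B) by exact: density_cutoff.
  have dfB : density (cutoff f B) by exact: density_cutoff.
  have le : (mass (cutoff p B) <= mass (cutoff f B))%E.
    by apply: le_mass => // x; rewrite /cutoff ler_wpM2r.
  have e : mass (cutoff p B) = (rmass (cutoff p B))%:E.
    by apply: (@rmassE _ _ _ (rmass (cutoff f B))) => //; rewrite -fE.
  by split => //; rewrite -lee_fin -e -fE.
have [p1E p1le] := pE _ mB1; have [p2E p2le] := pE _ mC1.
have Wpb1 : (W (cutoff p (cball 0 R1)) b <= (S1 * m * rmass a)%:E)%E.
  apply: (@le_trans _ _ (S1 * rmass (cutoff p (cball 0 R1)) * rmass a)%:E).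
    by apply: interaction_le_cst => // x y /cutoff_neq0; exact: gS1.
  by rewrite lee_fin ler_wpM2r// ler_wpM2l// (le_trans p1le).
have Wpb2 : (W (cutoff p (~` cball 0 R1)) b <= (S2 * rmass q2 * rmass a)%:E)%E.
  apply: (@le_trans _ _ (S2 * rmass (cutoff p (~` cball 0 R1)) * rmass a)%:E).
    apply: interaction_le_cst => // x y px /bQ yQ.
    have xB : cball 0 R2 x.
      apply: (@cutoff_neq0 _ _ f); apply: contra_neq px => px0.
      by rewrite /cutoff [p x]px0 mul0r.
    exact: le_trans (ler_norm _) (S2P _ (cball0_subr xB yQ (lexx _))).
  by rewrite lee_fin ler_wpM2r// ler_wpM2l.
have Wpb : (W p b <= (S1 * m * rmass a + S2 * rmass q2 * rmass a)%:E)%E.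
  rewrite (congr1 (W^~ b) (cutoff_split p (cball 0 R1))) (interactionDl mg g0 d1 d2 db).
  by rewrite EFinD; exact: leeD.
have Wbb : (W b b <= (S1 * rmass a * rmass a)%:E)%E.
  apply: interaction_le_cst => // x y /bQ xQ /bQ yQ; apply: le_trans (ler_norm _) (S1P _ (cball0_subr xQ yQ _)).
  by rewrite -lerBlDr (le_trans _ R10)// subrr.
have Waa := interaction_ge0 g0 da da.
have := le_trans (le_trans (leeD (leeD Wpa Wpa) Waa) key) (leeD (leeD Wpb Wpb) Wbb).
rewrite adde0 -!EFinD lee_fin => fin.
have loss' : K * rmass q2 <= m by rewrite -ler_pdivlMl.
have q1q2 : rmass q1 = m - rmass q2 by rewrite q1s addrK.
by rewrite q1q2 in fin; exact: escape_costs S10 S20 m0 q20 a_gt0 aq2 loss' fin.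
Qed.

End compact_support.

(** * Potentials of minimizers *)
Section euler_lagrange.
Context {R : realType} {n : nat}.
Local Notation V := 'rV[R]_n.
Local Notation leb := (lebesgue_rV R n).
Variable g : V -> R.
Hypothesis cg : continuous g.
Hypothesis g0 : forall x, 0 <= g x.
Hypothesis ge : forall x, g (- x) = g x.
Local Notation W := (interaction g).
Let mg : measurable_fun setT g := continuous_measurable_rV cg.

Lemma interaction_le_potential a f (k s : R) : density a -> density f -> mass a = s%:E -> 0 <= k ->
  (forall x, a x != 0 -> (density_potential g f x <= k%:E)%E) -> (W a f <= (k * s)%:E)%E.
Proof.
move=> da df ma k0 fk; rewrite (interaction_potentialE mg g0 da df) EFinM -ma /mass -ge0_integralZl_EFin//; last 2 first.
- by move=> x _; rewrite lee_fin; exact: da.2.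
- by apply/measurable_EFinP; exact: da.1.
apply: ge0_le_integral => //.
- by move=> x _; rewrite mule_ge0// ?lee_fin; [exact: da.2 | exact: density_potential_ge0].
- by apply: emeasurable_funM; [apply/measurable_EFinP; exact: da.1 | exact: measurable_density_potential].
- by apply: measurable_funeM; apply/measurable_EFinP; exact: da.1.
move=> x _; have [->|ax] := eqVneq (a x) 0; first by rewrite mul0e mule0.
by rewrite muleC lee_wpmul2r ?lee_fin ?fk//; exact: da.2.
Qed.

Lemma interaction_ge_potential a f (k s : R) : density a -> density f -> mass a = s%:E -> 0 <= k ->
  (forall x, a x != 0 -> (k%:E <= density_potential g f x)%E) -> ((k * s)%:E <= W a f)%E.
Proof.
move=> da df ma k0 fk; rewrite (interaction_potentialE mg g0 da df) EFinM -ma /mass -ge0_integralZl_EFin//; last 2 first.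
- by move=> x _; rewrite lee_fin; exact: da.2.
- by apply/measurable_EFinP; exact: da.1.
apply: ge0_le_integral => //.
- by move=> x _; rewrite mule_ge0// ?lee_fin//; exact: da.2.
- by apply: measurable_funeM; apply/measurable_EFinP; exact: da.1.
- by apply: emeasurable_funM; [apply/measurable_EFinP; exact: da.1 | exact: measurable_density_potential].
move=> x _; have [->|ax] := eqVneq (a x) 0; first by rewrite mul0e mule0.
by rewrite muleC lee_wpmul2l ?lee_fin ?fk//; exact: da.2.
Qed.

Lemma measure_pos_bigcup (A : set V) (F : nat -> set V) : measurable A ->
  (forall k, measurable (F k)) -> A `<=` \bigcup_k F k -> leb A != 0%E ->
  exists k, leb (A `&` F k) != 0%E.
Proof.
move=> mA mF AF A0; apply: contrapT => /forallNP nF; move/eqP: A0; apply.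
have N : leb.-negligible (\bigcup_k (A `&` F k)).
  apply: negligible_bigcup => k; apply/negligibleP; first exact: measurableI.
  by apply/eqP; have := nF k; case: eqP.
apply/negligibleP => //; apply: (negligibleS _ N).
by move=> x Ax; have [k _ Fk] := AF x Ax; exists k.
Qed.

Definition uniform_density (s : R) (A : set V) (x : V) : R := s / fine (leb A) * \1_A x.

Lemma uniform_densityP s (A : set V) (c : V) (r : R) : measurable A -> A `<=` cball c r ->
  leb A != 0%E -> 0 <= s ->
  [/\ density (uniform_density s A), mass (uniform_density s A) = s%:E &
      forall x, uniform_density s A x <= s / fine (leb A) /\ (uniform_density s A x != 0 -> A x)].
Proof.
move=> mA Ac A0 s0.
have Afin : leb A \is a fin_num.
  rewrite ge0_fin_numE//; apply: le_lt_trans (lebesgue_cball_lty c r).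
  by apply: le_measure; rewrite ?inE//; exact: measurable_cball.
have A0' : 0 < fine (leb A) by rewrite fine_gt0// lt0e A0 measure_ge0 -ge0_fin_numE.
have d1 : density (\1_A : V -> R) by split => //; exact: measurable_indic.
have k0 : 0 <= s / fine (leb A) by rewrite divr_ge0// ltW.
split.
- exact: densityZ.
- rewrite massZ// /mass integral_indic// setIT -[X in (_ * X)%E]fineK// -EFinM divfK//.
  by rewrite gt_eqF.
- move=> x; split.
    by rewrite /uniform_density ler_piMr// indicE lern1; case: (_ \in _).
  rewrite /uniform_density indicE; have [/set_mem//|_] := boolP (x \in A).
  by rewrite mulr0 eqxx.
Qed.

(** If both sets had positive measure, one could move a mass [s] from the part of
    [A] where [f] is bounded away from zero to the part of [B] where [f] is
    bounded away from one.  The gain is [2 * s * (be - al)] to first order, and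
    the remaining terms are at most [2 * S * s ^ 2]. *)
Lemma optimal_potential_order m f (al be r : R) (A B : set V) :
  optimal g m f -> (W f f < +oo)%E -> 0 <= al -> al < be ->
  measurable A -> measurable B -> A `<=` cball 0 r -> B `<=` cball 0 r ->
  (forall x, A x -> 0 < f x /\ (be%:E <= density_potential g f x)%E) ->
  (forall x, B x -> f x < 1 /\ (density_potential g f x <= al%:E)%E) ->
  leb A = 0%E \/ leb B = 0%E.
Proof.
move=> fopt Wf al0 albe mA mB Ar Br AP BP.
have [|A0] := eqVneq (leb A) 0%E; first by left.
have [|B0] := eqVneq (leb B) 0%E; first by right.
exfalso.
have [[df f1 fm] _] := fopt; have [mf f0] := df.
pose FA k := [set x | k.+1%:R^-1 <= f x].
pose FB k := [set x | f x <= 1 - k.+1%:R^-1].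
have mFA k : measurable (FA k) by exact: measurable_le_set.
have mFB k : measurable (FB k) by exact: measurable_le_set.
have [ka A1] : exists k, leb (A `&` FA k) != 0%E.
  apply: measure_pos_bigcup => // x /AP[fx _].
  by have [k kf] := natSinv_le fx; exists k.
have [kb B1] : exists k, leb (B `&` FB k) != 0%E.
  apply: measure_pos_bigcup => // x /BP[fx _].
  have fx0 : 0 < 1 - f x by rewrite subr_gt0.
  have [k kf] := natSinv_le fx0; exists k => //; rewrite /FB /=.
  by rewrite lerBrDr addrC -lerBrDr.
set A' := A `&` FA ka in A1; set B' := B `&` FB kb in B1.
have mA' : measurable A' by exact: measurableI.
have mB' : measurable B' by exact: measurableI.
have A'r : A' `<=` cball 0 r by move=> x [/Ar].
have B'r : B' `<=` cball 0 r by move=> x [/Br].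
have [S S0 SP] := continuous_bounded_cball 0 (r + r) cg.
have gS x y : cball 0 r x -> cball 0 r y -> g (x - y) <= S.
  by move=> xr yr; exact: le_trans (ler_norm _) (SP _ (cball0_subr xr yr (lexx _))).
pose la := fine (leb A'); pose lb := fine (leb B').
have pos C : C `<=` cball 0 r -> measurable C -> leb C != 0%E -> 0 < fine (leb C).
  move=> Cr mC C0; have Cfin : leb C \is a fin_num.
    rewrite ge0_fin_numE//; apply: le_lt_trans (lebesgue_cball_lty 0 r).
    by apply: le_measure; rewrite ?inE//; exact: measurable_cball.
  by rewrite fine_gt0// lt0e C0 measure_ge0 -ge0_fin_numE.
have la0 : 0 < la by exact: pos.
have lb0 : 0 < lb by exact: pos.
(* The first bound makes the second-order terms lose, the other two keep [f]
   between 0 and 1. *)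
pose s := Num.min ((be - al) / (S + 1)) (Num.min (la / ka.+1%:R) (lb / kb.+1%:R)).
have S1 : 0 < S + 1 by rewrite ltr_wpDl.
have s0 : 0 < s.
  by rewrite !lt_min !divr_gt0// subr_gt0.
have sS : s * (S + 1) <= be - al.
  by rewrite -ler_pdivlMr// ge_min lexx.
have sa : s / la <= ka.+1%:R^-1.
  by rewrite ler_pdivrMr// mulrC !ge_min lexx orbT.
have sb : s / lb <= kb.+1%:R^-1.
  by rewrite ler_pdivrMr// mulrC !ge_min lexx !orbT.
have [da ma aP] := uniform_densityP mA' A'r A1 (ltW s0).
have [db mb bP] := uniform_densityP mB' B'r B1 (ltW s0).
set a := uniform_density s A' in da ma aP; set b := uniform_density s B' in db mb bP.
have af x : a x <= f x.
  have [->|ax] := eqVneq (a x) 0; first exact: f0.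
  have [_ /(_ ax)[_ fx]] := aP x.
  by apply: le_trans (aP x).1 _; exact: le_trans sa fx.
pose p x := f x - a x.
have dp : density p.
  by split; [apply: measurable_funB => //; exact: da.1 | move=> x; rewrite subr_ge0].
have fpa : f = (fun x => p x + a x) by apply/funext => x; rewrite subrK.
have pb1 x : p x + b x <= 1.
  have pf : p x <= f x by rewrite gerBl//; exact: da.2.
  have [->|bx] := eqVneq (b x) 0; first by rewrite addr0 (le_trans pf).
  have [_ /(_ bx)[_ fx]] := bP x.
  have := (bP x).1 => bx1; rewrite /FB /= in fx.
  have bk : b x <= kb.+1%:R^-1 by exact: le_trans bx1 sb.
  by rewrite (le_trans (lerD pf bk))// -lerBrDr.
have key := optimal_exchange mg g0 ge fopt Wf fpa dp da db pb1 (etrans ma (esym mb)).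
have Wfa : ((be * s)%:E <= W a f)%E.
  apply: interaction_ge_potential => //; first by rewrite ltW// (le_lt_trans al0).
  by move=> x /(aP x).2 [/AP[]].
have Wfb : (W b f <= (al * s)%:E)%E.
  by apply: interaction_le_potential => // x /(bP x).2 [/BP[]].
have Wbb : (W b b <= (S * s * s)%:E)%E.
  by apply: interaction_le_cst => // x y /(bP x).2/B'r xB /(bP y).2/B'r yB; exact: gS.
have Waa : (W a a <= (S * s * s)%:E)%E.
  by apply: interaction_le_cst => // x y /(aP x).2/A'r xB /(aP y).2/A'r yB; exact: gS.
have Wpb : (W p b <= (al * s)%:E)%E.
  apply: le_trans Wfb; rewrite (interactionC mg g0 ge db df).
  apply: le_interaction => // x y; rewrite ler_wpM2r//; first exact: db.2.
  by rewrite ler_wpM2l// gerBl//; exact: da.2.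
have Wpa : W a f = (W p a + W a a)%E.
  rewrite (interactionC mg g0 ge da df) -(interactionDl mg g0 dp da da).
  by congr (interaction g _ a); exact: fpa.
move: Wfa key; rewrite Wpa.
have := interaction_ge0 g0 da da; have := interaction_ge0 g0 dp da.
have numeric (x y z t : \bar R) : (0 <= x -> 0 <= y -> y <= (S * s * s)%:E ->
    z <= (al * s)%:E -> t <= (S * s * s)%:E -> (be * s)%:E <= x + y ->
    x + x + y <= z + z + t -> False)%E.
  clear -s0 sS albe S0 al0.
  move=> x0 y0 yS zS tS xy le.
  have := leeD (leeD xy xy) (lexx 0%E); rewrite adde0.
  have {le}le : (x + x + y <= ((al * s) + (al * s) + S * s * s)%:E)%E.
    by apply: le_trans le _; rewrite !EFinD; apply: leeD => //; exact: leeD.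
  move: x0 y0 xy le yS; case: x => [x||]//; case: y => [y||]// x0 y0 xy.
  rewrite -!EFinD !lee_fin => le yS le2.
  have h : be * s + be * s <= al * s + al * s + S * s * s + S * s * s by lra.
  have : s * (s * (S + 1)) <= s * (be - al) by rewrite ler_wpM2l// ltW.
  have : 0 < s * s by rewrite mulr_gt0.
  have : 0 <= S * s * s by rewrite !mulr_ge0// ltW.
  lra.
move=> pa0 aa0 h1 h2; exact: numeric pa0 aa0 Waa Wpb Wbb h1 h2.
Qed.

End euler_lagrange.

(** * Directional derivatives and chords *)
Section directional_derivatives.
Context {R : realType} {n : nat}.
Local Notation V := 'rV[R]_n.
Implicit Types (g k w : V -> R) (x z u v : V).

(** Differentiability at [z] in the direction [v], in the form of a first-order
    expansion, which passes under an average without division by [h]. *)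
Definition has_dd g z v (d : R) := forall e, 0 < e -> exists2 r, 0 < r &
  forall h, `|h| <= r -> `|g (z + h *: v) - g z - h * d| <= e * `|h|.

Lemma continuousP_norm g : continuous g <->
  forall x e, 0 < e -> exists2 r, 0 < r & forall y, `|y - x| <= r -> `|g y - g x| <= e.
Proof.
split=> [cg x e e0|h x].
  have /(@cvgrPdist_le R R _ (nbhs x) _ g (g x))/(_ e e0)/nbhs_ballP[r /= r0 rP] := cg x.
  exists (r / 2); first by rewrite divr_gt0.
  move=> y yx; rewrite distrC; apply: rP; rewrite -ball_normE /= distrC.
  by rewrite (le_lt_trans yx)// ltr_pdivrMr// ltr_pMr// ltr1n.
apply/(@cvgrPdist_le R R _ (nbhs x) _ g (g x)) => e e0; have [r r0 rP] := h x e e0.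
apply/nbhs_ballP; exists r => //= y; rewrite -ball_normE /= => xy.
by rewrite distrC rP// distrC ltW.
Qed.

Lemma has_dd_is_derive g z v d : has_dd g z v d -> is_derive z v g d.
Proof.
move=> gd.
have c : (fun h : R => h^-1 *: ((g \o shift z) (h *: v) - g z)) @ 0^' --> d.
  apply/cvgrPdist_le => e e0; have [r r0 rP] := gd e e0.
  apply/nbhs_ballP; exists r => //= h; rewrite -ball_normE /= sub0r normrN => hr h0.
  rewrite -(ler_pM2r (_ : 0 < `|h|)) ?normr_gt0// -normrM mulrBl distrC.
  have -> : h^-1 *: (g (h *: v + z) - g z) * h = g (z + h *: v) - g z.
    by rewrite [_ *: _]mulrC divfK// [h *: v + z]addrC.
  by rewrite [d * h]mulrC; apply: rP; exact: ltW.
split; first by apply/cvg_ex; exists d.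
by apply/cvg_lim.
Qed.

Lemma derivable_has_dd g z v : derivable g z v -> has_dd g z v ('D_v g z).
Proof.
move=> dg e e0; have /cvgrPdist_le/(_ e e0)/nbhs_ballP[r /= r0 rP] := dg.
exists (r / 2); first by rewrite divr_gt0.
move=> h hr; have [->|h0] := eqVneq h 0.
  by rewrite scale0r addr0 subrr mul0r subr0 normr0 mulr0.
have hb : ball (0 : R) r h.
  rewrite -ball_normE /= sub0r normrN.
  by rewrite (le_lt_trans hr)// ltr_pdivrMr// ltr_pMr// ltr1n.
have := rP h hb h0; rewrite /= -(ler_pM2r (_ : 0 < `|h|)) ?normr_gt0// -normrM mulrBl distrC.
have -> : h^-1 *: (g (h *: v + z) - g z) * h = g (z + h *: v) - g z.
  by rewrite [_ *: _]mulrC divfK// [h *: v + z]addrC.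
by rewrite [_ * h]mulrC.
Qed.

Lemma has_dd_derive g z v d : has_dd g z v d -> 'D_v g z = d.
Proof. by move=> /has_dd_is_derive dg; rewrite derive_val. Qed.

Lemma has_dd_scale g z v d (a : R) :
  has_dd g z v d -> has_dd (fun x => a * g x) z v (a * d).
Proof.
move=> gd e e0.
have a0 : 0 < `|a| + 1 by rewrite ltr_wpDl.
have [r r0 rP] := gd (e / (`|a| + 1)) (divr_gt0 e0 a0).
exists r => // h hr; have -> : a * g (z + h *: v) - a * g z - h * (a * d) =
  a * (g (z + h *: v) - g z - h * d) by ring.
rewrite normrM (le_trans (ler_wpM2l (normr_ge0 a) (rP h hr)))//.
rewrite mulrA ler_wpM2r// mulrCA ger_pMr//.
by rewrite ler_pdivrMr// mul1r lerDl.
Qed.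

Lemma has_ddD g k z v d d' : has_dd g z v d -> has_dd k z v d' ->
  has_dd (fun x => g x + k x) z v (d + d').
Proof.
move=> gd kd e e0; have e2 : 0 < e / 2 by rewrite divr_gt0.
have [r r0 rP] := gd _ e2; have [s s0 sP] := kd _ e2.
exists (Num.min r s); first by rewrite lt_min r0.
move=> h; rewrite le_min => /andP[hr hs].
have -> : g (z + h *: v) + k (z + h *: v) - (g z + k z) - h * (d + d') =
  (g (z + h *: v) - g z - h * d) + (k (z + h *: v) - k z - h * d') by ring.
by rewrite (le_trans (ler_normD _ _))// [e]splitr mulrDl lerD// ?rP ?sP.
Qed.

Lemma has_dd_sum (I : finType) (G : I -> V -> R) (D : I -> R) z v :
  (forall i, has_dd (G i) z v (D i)) ->
  has_dd (fun x => \sum_i G i x) z v (\sum_i D i).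
Proof.
move=> GD; rewrite (_ : (fun x => _) = \sum_i G i); last first.
  by apply/funext => x; rewrite fct_sumE.
elim/big_rec2 : _ => [|i d f _ fd].
  move=> e e0; exists 1 => // h _.
  by rewrite /= subrr mulr0 subr0 normr0 mulr_ge0// ltW.
exact: has_ddD.
Qed.

Lemma has_dd_line_derive g v k z : (forall x, has_dd g x v (k x)) ->
  forall t : R, is_derive t 1 (fun t => g (z + t *: v)) (k (z + t *: v)).
Proof.
move=> gk t; have [d <-] := has_dd_is_derive (gk (z + t *: v)).
have E : (fun h : R => h^-1 *: (((fun t : R => g (z + t *: v)) \o shift t) (h *: 1) - g (z + t *: v))) =
  (fun h : R => h^-1 *: ((g \o shift (z + t *: v)) (h *: v) - g (z + t *: v))).
  apply/funext => h /=; congr (_ *: (g _ - _)).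
  by rewrite [h *: 1]mulr1 scalerDl addrCA.
by split; rewrite /derivable /derive E.
Qed.

Lemma real_mvt (p p' : R -> R) (a b : R) : a <= b ->
  (forall t : R, is_derive t (1 : R) p (p' t)) ->
  exists2 c, a <= c <= b & p b - p a = p' c * (b - a).
Proof.
move=> ab dp; have [|c] := @MVT_segment _ p p' a b ab (fun t _ => dp t).
  apply: continuous_subspaceT => t.
  by apply/differentiable_continuous/derivable1_diffP; exact: ex_derive.
by rewrite in_itv /= => cab E; exists c.
Qed.

Lemma has_dd_mvt g v k z (s : R) : (forall x, has_dd g x v (k x)) ->
  exists2 c, `|c| <= `|s| & g (z + s *: v) - g z = s * k (z + c *: v).
Proof.
move=> gk; have [s0|s0] := leP 0 s.
  have [c /andP[c0 cs]] := real_mvt s0 (has_dd_line_derive z gk).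
  rewrite scale0r addr0 subr0 mulrC => E; exists c => //.
  by rewrite !ger0_norm// (le_trans c0).
have [c /andP[cs c0]] := real_mvt (ltW s0) (has_dd_line_derive z gk).
rewrite scale0r addr0 sub0r => E; exists c.
  by rewrite !ler0_norm// ?lerN2// ltW.
by rewrite -opprB E mulrN opprK mulrC.
Qed.

(** The increment along [a *: u + v] is one along [v] followed by one along [u];
    the second is a value of [k] near [z] by the mean value theorem.  Iterated
    over the coordinates, this is the differentiability of functions of class C^1. *)
Lemma has_dd_addv g k z u v d (a : R) : (forall x, has_dd g x u (k x)) ->
  continuous k -> has_dd g z v d -> has_dd g z (a *: u + v) (a * k z + d).
Proof.
move=> gk /continuousP_norm ck gd e e0.
have e2 : 0 < e / 2 by rewrite divr_gt0.
have [r r0 rP] := gd _ e2.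
have a0 : 0 < `|a| + 1 by rewrite ltr_wpDl.
have [s s0 sP] := ck z _ (divr_gt0 e2 a0).
have K0 : 0 < `|v| + `|a| * `|u| + 1 by rewrite ltr_wpDl// addr_ge0// mulr_ge0.
exists (Num.min r (s / (`|v| + `|a| * `|u| + 1))).
  by rewrite lt_min r0 divr_gt0.
move=> h; rewrite le_min => /andP[hr hs].
have [c ch E] := has_dd_mvt (z + h *: v) (h * a) gk.
have -> : g (z + h *: (a *: u + v)) - g z - h * (a * k z + d) =
  (h * a) * (k (z + h *: v + c *: u) - k z) + (g (z + h *: v) - g z - h * d).
  have -> : z + h *: (a *: u + v) = z + h *: v + (h * a) *: u.
    by rewrite scalerDr scalerA addrAC addrA.
  rewrite mulrBr -E; ring.
rewrite (le_trans (ler_normD _ _))// [e]splitr mulrDl lerD ?rP//.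
have nk : `|k (z + h *: v + c *: u) - k z| <= e / 2 / (`|a| + 1).
  have E0 : z + h *: v + c *: u - z = h *: v + c *: u.
    by rewrite -!addrA addrC -!addrA addNr addr0.
  apply: sP; rewrite E0 (le_trans (ler_normD _ _))// !normrZ.
  move: hs; rewrite ler_pdivlMr// => /(le_trans _); apply.
  rewrite mulrDr mulr1 mulrDr -addrA lerD//.
  rewrite ler_wpDr//; apply: (le_trans (ler_wpM2r (normr_ge0 u) ch)).
  by rewrite normrM mulrA.
rewrite !normrM (le_trans (ler_wpM2l (mulr_ge0 (normr_ge0 h) (normr_ge0 a)) nk))//.
rewrite -mulrA [leRHS]mulrC ler_wpM2l// mulrA ler_pdivrMr// mulrC ler_wpM2l ?lerDl//.
exact: ltW.
Qed.

Lemma Ck1_has_dd g v z : Ck 1 g ->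
  has_dd g z v (\sum_(i < n) v ord0 i * 'D_(delta_mx ord0 i) g z).
Proof.
move=> [_ gD]; rewrite [v in has_dd _ _ v](row_sum_delta v).
elim/big_rec2 : _ => [|i u d _ ud].
  by move=> e e0; exists 1 => // h _; rewrite scaler0 addr0 mulr0 !subrr normr0 mulr_ge0// ltW.
have [dg cD] := gD i.
by apply: (@has_dd_addv g ('D_(delta_mx ord0 i) g)) => // x; exact: derivable_has_dd.
Qed.

Lemma continuous_sum_scaled (a : 'I_n -> R) (G : 'I_n -> V -> R) :
  (forall i, continuous (G i)) -> continuous (fun x => \sum_i a i * G i x).
Proof.
move=> cG x; rewrite (_ : (fun x => _) = \sum_i (fun x => a i * G i x)); last first.
  by apply/funext => y; rewrite fct_sumE.
elim/big_ind : _ => [|f1 f2 c1 c2|i _]; first exact: cst_continuous.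
  exact: continuousD.
by apply: continuousM; [exact: cst_continuous | exact: cG].
Qed.

Lemma Ck2_has_dd g v : Ck 2 g -> exists k w, [/\ continuous k, continuous w,
  forall x, has_dd g x v (k x) & forall x, has_dd k x v (w x)].
Proof.
move=> C2; have [cg gD] := C2.
exists (fun x => \sum_(i < n) v ord0 i * 'D_(delta_mx ord0 i) g x).
exists (fun x => \sum_(i < n) v ord0 i * (\sum_(j < n)
  v ord0 j * 'D_(delta_mx ord0 j) ('D_(delta_mx ord0 i) g) x)).
split.
- by apply: continuous_sum_scaled => i; have [_ []] := gD i.
- apply: continuous_sum_scaled => i; apply: continuous_sum_scaled => j.
  by have [_ [_ /(_ j)[_]]] := gD i.
- move=> x; apply: Ck1_has_dd; split => // i; have [d [c _]] := gD i; split => //.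
- move=> x; apply: has_dd_sum => i; apply: has_dd_scale; apply: Ck1_has_dd.
  by have [_] := gD i.
Qed.

Lemma chord_below (p p' : R -> R) (s T : R) : (forall t : R, is_derive t (1 : R) p (p' t)) ->
  (forall a b, 0 <= a -> a <= b -> b <= T -> p' a <= p' b) -> 0 < s -> s < T ->
  T * p s <= (T - s) * p 0 + s * p T.
Proof.
move=> dp p'mono s0 sT.
have [a /andP[a0 as_] Ea] := real_mvt (ltW s0) dp.
have [b /andP[sb bT] Eb] := real_mvt (ltW sT) dp.
have ab := p'mono a b a0 (le_trans as_ sb) bT.
have h : s * (T - s) * p' a <= s * (T - s) * p' b.
  by rewrite ler_wpM2l// mulr_ge0 ?ltW// subr_gt0.
have h1 : (T - s) * (p s - p 0) <= s * (p T - p s).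
  rewrite Ea Eb subr0; lra.
lra.
Qed.

(** On a segment where the second derivative is at least [q], subtracting
    [q / 2 * t ^ 2] leaves a convex function; [q] enters linearly, so that it can
    be averaged over the kernel argument afterwards. *)
Lemma has_dd_chord g k w v z (q s T : R) : (forall x, has_dd g x v (k x)) ->
  (forall x, has_dd k x v (w x)) -> (forall t, 0 <= t <= T -> q <= w (z + t *: v)) ->
  0 < s -> s < T ->
  T * g (z + s *: v) <= (T - s) * g z + s * g (z + T *: v) - q * (s * T * (T - s) / 2).
Proof.
move=> gk kw wq s0 sT.
have dl := has_dd_line_derive z gk; have dl' := has_dd_line_derive z kw.
have dp (t : R) : is_derive t 1 (fun t => g (z + t *: v) - q / 2 * t ^+ 2)
    (k (z + t *: v) - q * t).
  have dq : is_derive t 1 (fun t : R => q / 2 * t ^+ 2) (q * t).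
    by apply: is_derive_eq; rewrite /GRing.scale /=; field.
  exact: is_deriveB.
have mono (a b : R) : 0 <= a -> a <= b -> b <= T ->
    k (z + a *: v) - q * a <= k (z + b *: v) - q * b.
  move=> a0 ab bT; have [c /andP[ac cb] E] := real_mvt ab dl'.
  have : q * (b - a) <= w (z + c *: v) * (b - a).
    by rewrite ler_wpM2r ?subr_ge0// wq// (le_trans a0 ac) (le_trans cb).
  lra.
have := chord_below dp mono s0 sT; rewrite scale0r addr0; lra.
Qed.

End directional_derivatives.

(** * Averages of continuous functions over a ball *)
Section means.
Context {R : realType} {n : nat}.
Local Notation V := 'rV[R]_n.
Implicit Types (L : (V -> R) -> R) (p q g k w : V -> R).

(** Integration against a probability measure carried by [B].  The densities
    [f_j / m_j] and the limit [mu] enter the arguments on potentials only through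
    these properties, and so are treated alike. *)
Definition mean_on (B : set V) L := [/\
  forall (a : R) p q, continuous p -> continuous q ->
    L (fun x => a * p x + q x) = a * L p + L q,
  forall p q, continuous p -> continuous q -> (forall x, B x -> p x <= q x) -> L p <= L q &
  L (fun=> 1) = 1].

Lemma continuous_reflect (p : V -> R) (c : V) : continuous p -> continuous (fun y : V => p (c - y)).
Proof.
move=> /continuousP_norm cp; apply/continuousP_norm => x e e0.
have [r r0 rP] := cp (c - x) e e0; exists r => // y yx; apply: rP.
by rewrite opprB addrC addrA subrK distrC.
Qed.

Lemma continuous_linear2 (a : R) p q : continuous p -> continuous q ->
  continuous (fun x => a * p x + q x).
Proof.
move=> cp cq x; apply: (@continuousD _ _ _ (fun x => a * p x) q); last exact: cq.
by apply: continuousM; [exact: cst_continuous | exact: cp].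
Qed.

Lemma continuous_const (a : R) : continuous (fun _ : V => a : R).
Proof. by move=> x; exact: cst_continuous. Qed.

Section one_mean.
Variables (B : set V) (L : (V -> R) -> R).
Hypothesis ML : mean_on B L.

Lemma mean_linear (a : R) p q : continuous p -> continuous q ->
  L (fun x => a * p x + q x) = a * L p + L q.
Proof. by have [h _ _] := ML; exact: h. Qed.

Lemma mean_le p q : continuous p -> continuous q -> (forall x, B x -> p x <= q x) -> L p <= L q.
Proof. by have [_ h _] := ML; exact: h. Qed.

Lemma mean_eq p q : continuous p -> continuous q -> (forall x, B x -> p x = q x) -> L p = L q.
Proof.
by move=> cp cq pq; apply/eqP; rewrite eq_le !mean_le// => x Bx; rewrite pq.
Qed.

Lemma mean_affine p (a c : R) : continuous p -> L (fun x => a * p x + c) = a * L p + c.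
Proof.
move=> cp; rewrite mean_linear//; last exact: continuous_const.
have c1 := @continuous_const 1; have h := mean_linear c c1 c1.
have h1 := mean_linear (c - 1) c1 c1; have [_ _ L1] := ML.
rewrite (_ : (fun=> c) = (fun=> (c - 1) * 1 + 1)); last by apply/funext => x; ring.
by rewrite h1 L1; ring.
Qed.

Lemma mean_dist p q (e : R) : continuous p -> continuous q ->
  (forall x, B x -> `|p x - q x| <= e) -> `|L p - L q| <= e.
Proof.
move=> cp cq pq.
have le1 u v : continuous u -> continuous v -> (forall x, B x -> `|u x - v x| <= e) -> L u <= L v + e.
  move=> cu cv uv; have E := mean_affine 1 e cv; rewrite mul1r in E; rewrite -E.
  apply: mean_le => //; first by apply: continuous_linear2 => //; exact: continuous_const.
  by move=> x Bx; have := uv x Bx; rewrite mul1r ler_norml => /andP[_]; lra.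
rewrite ler_norml; apply/andP; split.
  have := le1 q p cq cp; rewrite -lerBlDl; move=> h.
  have := h _; rewrite lerNl opprB => -> // x Bx; rewrite distrC; exact: pq.
by rewrite lerBlDl; apply: le1.
Qed.

End one_mean.

(** Compactness of the ball makes the continuity of [x |-> p (x - y)] uniform in
    [y]. *)
Lemma uniform_shift (r : R) p (x0 : V) (e : R) : continuous p -> 0 < e ->
  exists2 d, 0 < d & forall x y, `|x - x0| <= d -> cball 0 r y ->
    `|p (x - y) - p (x0 - y)| <= e.
Proof.
move=> /continuousP_norm cp e0.
have /compact_near_coveringP cB := @compact_cball R n 0 r.
have : forall y, cball 0 r y -> \forall y' \near y & x \near x0,
    `|p (x - y') - p (x0 - y')| <= e.
  move=> y _; have [d d0 dP] := cp (x0 - y) (e / 2) (divr_gt0 e0 (ltr0Sn _ _)).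
  exists (ball y (d / 2), ball x0 (d / 2)).
    by split; apply: nbhsx_ballx; rewrite divr_gt0.
  move=> [y' x] [/=]; rewrite -!ball_normE /= => yy' xx'.
  have -> : p (x - y') - p (x0 - y') =
    (p (x - y') - p (x0 - y)) - (p (x0 - y') - p (x0 - y)) by ring.
  rewrite (le_trans (ler_normB _ _))// [e]splitr lerD// dP//.
    rewrite (_ : x - y' - (x0 - y) = (y - y') - (x0 - x)); last first.
      by rewrite !opprB addrACA [RHS]addrACA [x + y]addrC.
    by rewrite (le_trans (ler_normB _ _))// [d]splitr lerD// ltW.
  rewrite opprB addrC addrA subrK (le_trans (ltW yy'))//.
  by rewrite ler_pdivrMr// ler_pMr// ler1n.
move/(cB V (nbhs x0) (fun x y => `|p (x - y) - p (x0 - y)| <= e) _) => /nbhs_ballP[d /= d0 dP].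
exists (d / 2); first by rewrite divr_gt0.
move=> x y xd; apply: dP; rewrite -ball_normE /= distrC (le_lt_trans xd)//.
by rewrite ltr_pdivrMr// ltr_pMr// ltr1n.
Qed.

Section potentials.
Variable r : R.
Local Notation B := (cball (0 : V) r).

(** For [L] the integral against [mu], this is the potential of [mu]. *)
Definition convolve L g x := L (fun y => g (x - y)).

Lemma convolve_equicontinuous g (x0 : V) (e : R) : continuous g -> 0 < e ->
  exists2 d, 0 < d & forall L x, mean_on B L -> `|x - x0| <= d ->
    `|convolve L g x - convolve L g x0| <= e.
Proof.
move=> cg e0; have [d d0 dP] := uniform_shift r x0 cg e0.
exists d => // L x ML xd; apply: (mean_dist ML); [exact: continuous_reflect..|].
by move=> y By; exact: dP.
Qed.

Lemma convolve_has_dd L g k v x : mean_on B L -> continuous g -> continuous k ->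
  (forall x, has_dd g x v (k x)) -> has_dd (convolve L g) x v (convolve L k x).
Proof.
move=> ML cg ck gk e e0; have [d d0 dP] := uniform_shift r x ck e0.
have v0 : 0 < `|v| + 1 by rewrite ltr_wpDl.
exists (d / (`|v| + 1)); first by rewrite divr_gt0.
move=> h hd.
have cgx (z : V) : continuous (fun y : V => g (z - y)) by exact: continuous_reflect.
have ckx : continuous (fun y : V => k (x - y)) by exact: continuous_reflect.
have -> : convolve L g (x + h *: v) - convolve L g x - h * convolve L k x =
  convolve L g (x + h *: v) - L (fun y => h * k (x - y) + g (x - y)).
  by rewrite (mean_linear ML) // /convolve; ring.
apply: (mean_dist ML) => //; first exact: continuous_linear2.
move=> y By; have [c ch E] := has_dd_mvt (x - y) h gk.
have -> : x + h *: v - y = x - y + h *: v by rewrite addrAC.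
have -> : g (x - y + h *: v) - (h * k (x - y) + g (x - y)) =
  h * (k (x + c *: v - y) - k (x - y)).
  by rewrite [x + c *: v - y]addrAC mulrBr -E; ring.
rewrite normrM mulrC ler_wpM2r// dP// addrAC subrr add0r normrZ.
move: hd; rewrite ler_pdivlMr// => /(le_trans _); apply.
by rewrite (le_trans (ler_wpM2r (normr_ge0 v) ch))// ler_wpM2l// lerDl.
Qed.

(** By [has_dd_chord] and an average over [y], the potential lies strictly below
    its chords in the direction [v] near [x0]: the second derivative of
    [g (z - y)] is at least [w (x0 - y) - e] there, and its average is positive.
    The radius [d] does not depend on the average [L]. *)
Lemma convolve_no_three_levels g k w v (x0 : V) (e : R) :
  continuous g -> continuous w -> 0 < e ->
  (forall x, has_dd g x v (k x)) -> (forall x, has_dd k x v (w x)) ->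
  exists2 d, 0 < d & forall L z (s T : R), mean_on B L -> e < convolve L w x0 ->
    0 < s -> s < T -> cball x0 d z -> cball x0 d (z + T *: v) ->
    convolve L g z = convolve L g (z + s *: v) -> convolve L g z = convolve L g (z + T *: v) -> False.
Proof.
move=> cg cw e0 gk kw; have [d d0 dP] := uniform_shift r x0 cw e0.
exists d => // L z s T ML ewx s0 sT zd zTd zs zT.
have T0 : 0 < T by exact: lt_trans sT.
pose c := s * T * (T - s) / 2.
have c0 : 0 < c by rewrite divr_gt0// !mulr_gt0// subr_gt0.
have seg t : 0 <= t <= T -> `|z + t *: v - x0| <= d.
  move=> /andP[t0 tT]; have t1 : t / T <= 1 by rewrite ler_pdivrMr// mul1r.
  have t2 : 0 <= t / T by rewrite divr_ge0// ltW.
  have -> : z + t *: v - x0 = (1 - t / T) *: (z - x0) + (t / T) *: (z + T *: v - x0).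
    rewrite [z + T *: v - x0]addrAC [(t / T) *: (_ + _)]scalerDr scalerA divfK ?gt_eqF//.
    by rewrite addrA -scalerDl subrK scale1r addrAC.
  have t3 : 0 <= 1 - t / T by rewrite subr_ge0.
  rewrite (le_trans (ler_normD _ _))// (normrZ (1 - t / T)) (normrZ (t / T)) (ger0_norm t3) (ger0_norm t2).
  apply: le_trans (lerD (ler_wpM2l t3 zd) (ler_wpM2l t2 zTd)) _.
  by rewrite -mulrDl subrK mul1r.
have chord y : B y -> T * g (z + s *: v - y) <=
    ((T - s) * g (z - y) + s * g (z + T *: v - y)) - (w (x0 - y) - e) * c.
  move=> By; rewrite [z + s *: v - y]addrAC [z + T *: v - y]addrAC.
  apply: (has_dd_chord gk kw) => // u u0T.
  have := dP _ y (seg u u0T) By; rewrite [z + u *: v - y]addrAC ler_norml => /andP[+ _].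
  by lra.
have cr p (x : V) : continuous p -> continuous (fun y : V => p (x - y)) by exact: continuous_reflect.
have cc (a : R) := @continuous_const a.
have E1 : L (fun y => T * g (z + s *: v - y) + 0) = T * convolve L g (z + s *: v).
  by rewrite (mean_affine ML) ?addr0//; exact: cr.
have E2 : L (fun y => (T - s) * g (z - y) + (s * g (z + T *: v - y) +
    (- c * w (x0 - y) + e * c))) =
    (T - s) * convolve L g z + (s * convolve L g (z + T *: v) + (- c * convolve L w x0 + e * c)).
  rewrite (mean_linear ML); [|exact: cr|]; last first.
    by do 2?[apply: continuous_linear2; first exact: cr]; exact: cc.
  rewrite (mean_linear ML); [|exact: cr|]; last first.
    by apply: continuous_linear2; [exact: cr|exact: cc].
  by rewrite (mean_affine ML); [|exact: cr].
have : T * convolve L g (z + s *: v) <= (T - s) * convolve L g z +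
    (s * convolve L g (z + T *: v) + (- c * convolve L w x0 + e * c)).
  rewrite -E1 -E2; apply: (mean_le ML).
  - by apply: continuous_linear2; [exact: cr|exact: cc].
  - by do 3?[apply: continuous_linear2; first exact: cr]; exact: cc.
  - by move=> y /chord; lra.
rewrite -zs -zT => fin.
have : c * e < c * convolve L w x0 by rewrite ltr_pM2l.
lra.
Qed.

End potentials.

End means.

(** * The limit measure *)
Section weighted_means.
Context {R : realType} {n : nat}.
Local Notation V := 'rV[R]_n.
Variables (nu : {measure set V -> \bar R}) (w : V -> R) (r : R).
Implicit Types p q : V -> R.
Hypothesis mw : measurable_fun setT w.
Hypothesis w0 : forall x, 0 <= w x.
Hypothesis w1 : (\int[nu]_x (w x)%:E)%E = 1%E.
Hypothesis wB : {ae nu, forall x, ~ cball 0 r x -> w x = 0}.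
Local Notation B := (cball (0 : V) r).

Let wint : nu.-integrable setT (EFin \o w).
Proof.
apply/integrableP; split; first exact/measurable_EFinP.
rewrite (_ : (\int[nu]_x _)%E = 1%E) ?ltry//.
by rewrite -w1; apply: eq_integral => x _ /=; rewrite ger0_norm.
Qed.

Let cutw (p : V -> R) x : R := p x * \1_B x * w x.

Let measurable_cutw p : continuous p -> measurable_fun setT (cutw p).
Proof.
move=> cp; apply: measurable_funM => //; apply: measurable_funM.
  exact: continuous_measurable_rV.
by apply: measurable_indic; exact: measurable_cball.
Qed.

Let measurable_pw p : continuous p -> measurable_fun setT (fun x => p x * w x).
Proof. by move=> cp; apply: measurable_funM => //; exact: continuous_measurable_rV. Qed.

Let cutw_ae p : {ae nu, forall x, p x * w x = cutw p x}.
Proof.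
apply: filterS wB => x wx; rewrite /cutw indicE.
have [xB|xB] := pselect (B x); first by rewrite mem_set// mulr1.
by rewrite (wx xB) !mulr0.
Qed.

Let integrable_cutw p : continuous p -> nu.-integrable setT (EFin \o cutw p).
Proof.
move=> cp; have [S S0 SP] := continuous_bounded_cball 0 r cp.
apply: (@le_integrable _ _ _ _ _ measurableT _ (fun x => (S%:E * (w x)%:E)%E)).
- by apply/measurable_EFinP; exact: measurable_cutw.
- move=> x _ /=; rewrite lee_fin /cutw !normrM ler_wpM2r// (ger0_norm S0) indicE.
  by have [/set_mem/SP|_] := boolP (x \in B); rewrite ?normr1 ?mulr1// normr0 mulr0.
- exact: integrableZl.
Qed.

Lemma integrable_weighted p : continuous p ->
  nu.-integrable setT (EFin \o (fun x => p x * w x)).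
Proof.
move=> cp; have /integrableP[_ fin] := integrable_cutw cp.
apply/integrableP; split; first by apply/measurable_EFinP; exact: measurable_pw.
apply: le_lt_trans fin; rewrite le_eqVlt; apply/orP; left; apply/eqP.
apply: ae_eq_integral => //.
- by apply: measurableT_comp => //; apply/measurable_EFinP; exact: measurable_pw.
- by apply: measurableT_comp => //; apply/measurable_EFinP; exact: measurable_cutw.
- by apply: filterS (cutw_ae p) => x px _ /=; rewrite px.
Qed.

(** The weight is carried by the ball only almost everywhere, so comparisons on
    the ball are made after cutting the integrand off. *)
Lemma weighted_mean : mean_on B (fun p => \int[nu]_x (p x * w x)).
Proof.
split.
- move=> a p q cp cq.
  have ip := integrable_weighted cp; have iq := integrable_weighted cq.
  rewrite -RintegralZl// -RintegralD//.
    by apply: eq_Rintegral => x _; ring.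
  have := integrableZl measurableT a ip.
  by apply: eq_integrable => // x _ /=; rewrite EFinM.
- move=> p q cp cq pq.
  have E (s : V -> R) : continuous s -> \int[nu]_x (s x * w x) = \int[nu]_x cutw s x.
    move=> cs; rewrite /Rintegral; congr fine; apply: ae_eq_integral => //.
    + by apply/measurable_EFinP; exact: measurable_pw.
    + by apply/measurable_EFinP; exact: measurable_cutw.
    + by apply: filterS (cutw_ae s) => x px _ /=; rewrite px.
  rewrite (E p cp) (E q cq); apply: le_Rintegral => //; [exact: integrable_cutw..|].
  move=> x _; rewrite /cutw ler_wpM2r// indicE.
  by have [/set_mem/pq|_] := boolP (x \in B); rewrite ?mulr1// !mulr0.
- by rewrite /Rintegral; under eq_integral do rewrite mul1r; rewrite w1.
Qed.

End weighted_means.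

Section radial_tests.
Context {R : realType} {n : nat}.
Local Notation V := 'rV[R]_n.

Lemma continuous_norm : continuous (fun x : V => `|x| : R).
Proof.
by apply/continuousP_norm => x e e0; exists e => // y; exact: le_trans (ler_dist_dist _ _).
Qed.

Lemma compact_support_cball (p : V -> R) r : (forall x, ~ cball 0 r x -> p x = 0) ->
  compact (closure [set x | p x != 0]).
Proof.
move=> pr; apply: (@subclosed_compact _ _ (cball (0 : V) r)).
- exact: closed_closure.
- exact: compact_cball.
have cl := @closed_cball R n 0 r; rewrite closure_id in cl; rewrite cl.
apply: closureS => x /= px; apply: contrapT => xr.
by move: px; rewrite pr// eqxx.
Qed.

Definition hat (a : R) (x : V) : R := Num.max 0 (Num.min 1 (a + 1 - `|x|)).

Lemma hatP (a : R) : [/\ continuous (hat a), forall x, 0 <= hat a x <= 1,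
  forall x, cball 0 a x -> hat a x = 1 & forall x, ~ cball 0 (a + 1) x -> hat a x = 0].
Proof.
split.
- move=> x; apply: (@continuous_max R V (fun=> 0) (fun y => Num.min 1 (a + 1 - `|y|)) x); first exact: cst_continuous.
  apply: (@continuous_min R V (fun=> 1) (fun y => a + 1 - `|y|) x); first exact: cst_continuous.
  by apply: continuousB; [exact: cst_continuous | exact: continuous_norm].
- by move=> x; rewrite /hat le_max lexx ge_max ler01 ge_min lexx.
- move=> x; rewrite /cball /= subr0 => xa; rewrite /hat min_l ?max_r//.
  by rewrite lerBrDl lerD2r.
- move=> x /negP; rewrite -ltNge subr0 => xa; rewrite /hat max_l//.
  by rewrite ge_min subr_le0 (ltW xa) orbT.
Qed.

Definition annulus (r k : R) (x : V) : R := Num.max 0 (Num.min (`|x| - r) (k - `|x|)).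

Lemma annulusP (r k : R) : [/\ continuous (annulus r k), forall x, 0 <= annulus r k x,
  forall x, cball 0 r x -> annulus r k x = 0, forall x, ~ cball 0 k x -> annulus r k x = 0 &
  forall x, r < `|x| < k -> annulus r k x != 0].
Proof.
split.
- move=> x; apply: (@continuous_max R V (fun=> 0) (fun y => Num.min (`|y| - r) (k - `|y|)) x); first exact: cst_continuous.
  apply: (@continuous_min R V (fun y => `|y| - r) (fun y => k - `|y|) x).
    by apply: continuousB; [exact: continuous_norm | exact: cst_continuous].
  by apply: continuousB; [exact: cst_continuous | exact: continuous_norm].
- by move=> x; rewrite /annulus le_max lexx.
- move=> x; rewrite /cball /= subr0 => xr; rewrite /annulus max_l//.
  by rewrite ge_min subr_le0 xr.
- move=> x /negP; rewrite -ltNge subr0 => xa; rewrite /annulus max_l//.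
  by rewrite ge_min orbC subr_le0 (ltW xa).
- move=> x /andP[rx xk]; rewrite gt_eqF// /annulus lt_max lt_min !subr_gt0 rx xk.
  by rewrite orbT.
Qed.

End radial_tests.

Section vague_limit.
Context {R : realType} {n : nat}.
Local Notation V := 'rV[R]_n.
Local Notation leb := (lebesgue_rV R n).
Variables (m : nat -> R) (f : nat -> V -> R) (mu : probability V R).
Hypothesis m0 : forall j, 0 < m j.
Hypothesis fc : forall j, competitor (m j) (f j).
Hypothesis fmu : weak_star_cvg (fun j x => (m j)^-1 * f j x) mu.

Definition density_mean j (p : V -> R) : R := \int[leb]_x (p x * ((m j)^-1 * f j x)).

Let df j : density (f j). Proof. by have [] := fc j. Qed.
Let fm j : mass (f j) = (m j)%:E. Proof. by have [] := fc j. Qed.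
Let mi0 j : 0 <= (m j)^-1. Proof. by rewrite invr_ge0 ltW. Qed.

Let dw j : density (fun x => (m j)^-1 * f j x).
Proof. exact: densityZ. Qed.

Let w1 j : (\int[leb]_x ((m j)^-1 * f j x)%:E)%E = 1%E.
Proof.
have := @massZ _ _ (m j)^-1 (f j) (mi0 j) (df j).
by rewrite fm -EFinM mulVf ?gt_eqF.
Qed.

(** No mass is lost in the limit, as [mu] is a probability: a ball with more than
    [3 / 4] of the mass of [mu], slightly enlarged, has at least half of that of
    [f_j] for large [j]. *)
Lemma tight_vague_limit : exists2 R0, 0 <= R0 &
  \forall j \near \oo, m j / 2 <= rmass (cutoff (f j) (cball 0 R0)).
Proof.
have [k k34] : exists k : nat, ((3 / 4)%:E < mu (cball (0 : V) k%:R))%E.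
  have ndB : nondecreasing_seq (fun k : nat => cball (0 : V) k%:R).
    move=> i j ij; apply/subsetPset => x; rewrite /cball /= => /le_trans; apply.
    by rewrite ler_nat.
  have UB : \bigcup_k cball (0 : V) k%:R = setT.
    rewrite -subTset => x _; exists (Num.Def.archi_bound `|x|) => //.
    by rewrite /cball /= subr0; apply/ltW/archi_boundP.
  have mB k : measurable (cball (0 : V) k%:R) by exact: measurable_cball.
  have := @nondecreasing_cvg_mu _ _ _ mu _ mB (bigcupT_measurable _ mB) ndB.
  rewrite UB => /(_ (fun x => ((3 / 4)%:E < x)%E)) H.
  have [|k _ kP] := H _.
    apply: open_ereal_gt'; apply: (@lt_le_trans _ _ 1%E); first by rewrite lte_fin; lra.
    by rewrite le_eqVlt; apply/orP; left; apply/eqP/esym; exact: probability_setT.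
  by exists k; exact: (kP k (leqnn k)).
have [ch h01 h1 h0] := @hatP R n k%:R.
have hcvg := fmu ch (compact_support_cball h0).
have mh : measurable_fun setT (hat k%:R : V -> R) by exact: continuous_measurable_rV.
have hmu : 3 / 4 <= \int[mu]_x hat k%:R x.
  have fin : (\int[mu]_x (hat k%:R x)%:E <= 1)%E.
    rewrite -[leRHS](@probability_setT _ _ _ mu) -[leRHS]mul1e -integral_cst//.
    apply: ge0_le_integral => //.
    - by move=> x _; rewrite lee_fin; have /andP[] := h01 x.
    - exact/measurable_EFinP.
    - by move=> x _; rewrite lee_fin; have /andP[] := h01 x.
  have h_ge0 : (0 <= \int[mu]_x (hat k%:R x)%:E)%E.
    by apply: integral_ge0 => x _; rewrite lee_fin; have /andP[] := h01 x.
  rewrite -lee_fin /Rintegral fineK; last first.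
    by rewrite ge0_fin_numE// (le_lt_trans fin)// ltry.
  apply: (le_trans (ltW k34)).
  rewrite -[X in mu X]setIT -integral_indic//; last exact: measurable_cball.
  apply: ge0_le_integral => //.
  - by apply/measurable_EFinP/measurable_indic; exact: measurable_cball.
  - exact/measurable_EFinP.
  - move=> x _; rewrite lee_fin indicE.
    have [/set_mem/h1->//|_] := boolP (x \in _).
    by have /andP[] := h01 x.
exists (k%:R + 1); first by rewrite addr_ge0.
near=> j.
have hj : 1 / 2 < density_mean j (hat k%:R).
  near: j; apply: (cvgr_gt _ hcvg); apply: lt_le_trans hmu; lra.
have mB := measurable_cball (0 : V) (k%:R + 1).
have dcut := density_cutoff (df j) mB.
have [cE /andP[c0 _] _] := rmass_cutoff (df j) (fm j) mB.
suff : density_mean j (hat k%:R) <= (m j)^-1 * rmass (cutoff (f j) (cball 0 (k%:R + 1))).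
  move=> /(lt_le_trans hj)/ltW; rewrite ler_pdivlMl//; lra.
rewrite -lee_fin EFinM -cE -massZ//.
have up : (\int[leb]_x (hat k%:R x * ((m j)^-1 * f j x))%:E <=
    mass (fun x => (m j)^-1 * cutoff (f j) (cball 0 (k%:R + 1)) x)%R)%E.
  apply: ge0_le_integral => //.
  - by move=> x _; rewrite lee_fin mulr_ge0//; [have /andP[] := h01 x | exact: (dw j).2].
  - by apply/measurable_EFinP; apply: measurable_funM => //; exact: (dw j).1.
  - by apply/measurable_EFinP; exact: (densityZ (mi0 j) dcut).1.
  - move=> x _; rewrite lee_fin /cutoff indicE.
    have [_|/negP xB] := boolP (x \in _).
      by rewrite mulr1 ler_piMl//; [exact: (dw j).2 | have /andP[] := h01 x].
    by rewrite h0 ?mul0r ?mulr0// => xB'; apply: xB; rewrite mem_set.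
rewrite /density_mean /Rintegral fineK// ge0_fin_numE.
  by apply: le_lt_trans up _; rewrite massZ// cE -EFinM ltry.
apply: integral_ge0 => x _.
by rewrite lee_fin mulr_ge0//; [have /andP[] := h01 x | exact: (dw j).2].
Unshelve. all: by end_near. Qed.

Variable r : R.
Hypothesis supp : \forall j \near \oo, mass (cutoff (f j) (~` cball 0 r)) = 0%E.

Let wB j : mass (cutoff (f j) (~` cball 0 r)) = 0%E ->
  {ae leb, forall x, ~ cball 0 r x -> (m j)^-1 * f j x = 0}.
Proof.
move=> cut0; have dcut : density (cutoff (f j) (~` cball 0 r)).
  by apply: density_cutoff => //; apply: measurableC; exact: measurable_cball.
apply: filterS (mass_eq0 dcut cut0) => x + xB.
by rewrite /cutoff indicE mem_set// mulr1 => ->; rewrite mulr0.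
Qed.

Lemma density_mean_on : \forall j \near \oo, mean_on (cball 0 r) (density_mean j).
Proof.
apply: filterS supp => j cut0; apply: weighted_mean.
- exact: (dw j).1.
- exact: (dw j).2.
- exact: w1.
- exact: wB.
Qed.

(** The extended-valued potential of a density is a finite average, since the
    density is carried by a ball. *)
Lemma density_potential_mean g j x : continuous g ->
  mass (cutoff (f j) (~` cball 0 r)) = 0%E ->
  density_potential g (f j) x = (m j * convolve (density_mean j) g x)%:E.
Proof.
move=> cg cut0.
have ig := integrable_weighted (dw j).1 (dw j).2 (w1 j) (wB cut0)
  (continuous_reflect (c := x) cg).
have gfin := integrable_fin_num measurableT ig.
rewrite /convolve /density_mean EFinM /Rintegral fineK// -integralZl//.
apply: eq_integral => y _ /=; rewrite -EFinM; congr EFin.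
by field; rewrite gt_eqF.
Qed.

(** The complement of the ball is a countable union of the positivity sets of
    compactly supported functions that vanish on the ball, and these have
    integral zero against [f_j] for large [j]. *)
Lemma vague_limit_support : mu (~` cball 0 r) = 0%E.
Proof.
have UA : ~` cball (0 : V) r = \bigcup_k [set x : V | r < `|x| < k%:R].
  apply/seteqP; split => [x|x [k _] /= /andP[rx _]].
    move=> /negP; rewrite -ltNge subr0 => rx.
    by exists (Num.Def.archi_bound `|x|) => //=; rewrite rx archi_boundP.
  by apply/negP; rewrite -ltNge subr0.
apply/negligibleP; first by apply: measurableC; exact: measurable_cball.
rewrite UA; apply: negligible_bigcup => k.
have [ca a0 ar ak apos] := @annulusP R n r k%:R.
have acvg := fmu ca (compact_support_cball ak).
have aint0 : \int[mu]_x annulus r k%:R x = 0.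
  apply: (cvg_unique _ acvg) => //.
  apply: cvg_near_cst; apply: filterS supp => j cut0.
  rewrite /Rintegral (ae_eq_integral (cst 0)) ?integral0//.
  - apply/measurable_EFinP; apply: measurable_funM; last exact: (dw j).1.
    exact: continuous_measurable_rV.
  - apply: filterS (wB cut0) => x xr _ /=.
    have [xB|xB] := pselect (cball 0 r x); first by rewrite ar// mul0r.
    by rewrite xr// mulr0.
have ma : measurable_fun setT (annulus r k%:R : V -> R) by exact: continuous_measurable_rV.
have [S S0 SP] := continuous_bounded_cball 0 k%:R ca.
have aS (x : V) : annulus r k%:R x <= S.
  have [xB|xB] := pselect (cball 0 k%:R x); last by rewrite (ak _ xB).
  exact: le_trans (ler_norm _) (SP x xB).
have afin : (\int[mu]_x (annulus r k%:R x)%:E)%E \is a fin_num.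
  rewrite ge0_fin_numE; last by apply: integral_ge0 => x _; rewrite lee_fin.
  apply: (@le_lt_trans _ _ (\int[mu]_x (cst S%:E) x)%E).
    apply: ge0_le_integral => //; first by move=> x _; rewrite lee_fin.
    - exact/measurable_EFinP.
    - by move=> x _; rewrite lee_fin.
  rewrite integral_cst//; apply: (@le_lt_trans _ _ (S%:E * 1)%E); last by rewrite mule1 ltry.
  by apply: lee_wpmul2l; [rewrite lee_fin | exact: probability_le1].
have a00 : (\int[mu]_x `|(EFin \o annulus r k%:R) x| = 0)%E.
  rewrite -[RHS]/(0%:E) -aint0 /Rintegral fineK//.
  by apply: eq_integral => x _ /=; rewrite ger0_norm.
have mae : measurable_fun setT (EFin \o (annulus r k%:R : V -> R)) by exact/measurable_EFinP.
have [+ _] := ae_eq_integral_abs mu measurableT mae.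
move=> /(_ a00) [N [mN N0 aN]]; exists N; split => // x xk; apply: aN => /= /(_ I) [].
by apply/eqP; exact: apos.
Qed.

Lemma limit_mean_on : mean_on (cball 0 r) (fun p : V -> R => \int[mu]_x p x).
Proof.
have := @weighted_mean R n mu (fun=> 1) r.
have -> : (fun p : V -> R => \int[mu]_x (p x * 1)) = (fun p : V -> R => \int[mu]_x p x).
  by apply/funext => p; apply: eq_Rintegral => x _; rewrite mulr1.
apply => //.
  by rewrite integral_cst// mul1e; exact: probability_setT.
exists (~` cball 0 r); split => //.
- by apply: measurableC; exact: measurable_cball.
- exact: vague_limit_support.
- by move=> x /= nx xB; apply: nx.
Qed.

(** Outside the ball the test function is invisible, so it can be multiplied by a
    cutoff. *)
Lemma density_mean_cvg p : continuous p ->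
  density_mean j p @[j --> \oo] --> \int[mu]_x p x.
Proof.
move=> cp; have [ch h01 h1 h0] := @hatP R n r.
have cph : continuous (fun x => p x * hat r x).
  by move=> x; apply: continuousM; [exact: cp | exact: ch].
have ph0 x : ~ cball 0 (r + 1) x -> p x * hat r x = 0 by move=> /h0 ->; rewrite mulr0.
have phE x : cball 0 r x -> p x * hat r x = p x by move=> /h1 ->; rewrite mulr1.
rewrite -(mean_eq limit_mean_on cph cp phE).
apply: cvg_trans (fmu cph (compact_support_cball ph0)).
apply: near_eq_cvg; apply: filterS density_mean_on => j mj.
exact: (mean_eq mj cph cp phE).
Qed.

End vague_limit.

(** * The set where a minimizer takes intermediate values *)
Section no_intermediate_values.
Context {R : realType} {n : nat}.
Local Notation V := 'rV[R]_n.
Local Notation leb := (lebesgue_rV R n).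
Variable g : V -> R.
Hypothesis cg : continuous g.
Hypothesis g0 : forall x, 0 <= g x.
Hypothesis ge : forall x, g (- x) = g x.
Let mg : measurable_fun setT g := continuous_measurable_rV cg.

Section one_minimizer.
Variables (m : R) (f : V -> R) (psi : V -> R).
Hypothesis m0 : 0 < m.
Hypothesis m1 : m <= 1.
Hypothesis fopt : optimal g m f.
Hypothesis potentialE : forall x, density_potential g f x = (m * psi x)%:E.

Let df : density f. Proof. by have [[]] := fopt. Qed.

Definition intermediate : set V := [set x | 0 < f x < 1].

Lemma measurable_psi : measurable_fun setT psi.
Proof.
have -> : psi = (fun x => m^-1 * fine (density_potential g f x)).
  by apply/funext => x; rewrite potentialE /= mulKf// gt_eqF.
apply: measurable_funM => //; apply: measurableT_comp => //; exact: measurable_density_potential.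
Qed.

Lemma psi_ge0 x : 0 <= psi x.
Proof.
have := density_potential_ge0 g0 x df; rewrite potentialE lee_fin.
by rewrite pmulr_rge0.
Qed.

Lemma optimal_psi_order (al be rho : R) (A B : set V) : al < be ->
  measurable A -> measurable B -> A `<=` cball 0 rho -> B `<=` cball 0 rho ->
  (forall x, A x -> 0 < f x /\ be <= psi x) ->
  (forall x, B x -> f x < 1 /\ psi x <= al) ->
  leb A = 0%E \/ leb B = 0%E.
Proof.
move=> albe mA mB Ar Br AP BP.
have [al0|al0] := leP 0 al; last first.
  right; rewrite (_ : B = set0) ?measure0//; apply/seteqP; split => // x /BP[_ h].
  by have := psi_ge0 x; rewrite leNgt (le_lt_trans h).
have Wf : (interaction g f f < +oo)%E.
  exact: (@optimal_energy_lty _ _ _ cg g0 ge (fun=> m) (fun=> f) (fun=> fopt) 0%N).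
apply: (@optimal_potential_order _ _ g cg g0 ge m f (m * al) (m * be) rho) => //.
- by rewrite mulr_ge0// ltW.
- by rewrite ltr_pM2l.
- by move=> x /AP[? ?]; split => //; rewrite potentialE lee_fin ler_pM2l.
- by move=> x /BP[? ?]; split => //; rewrite potentialE lee_fin ler_pM2l.
Qed.

Lemma measurable_intermediate : measurable intermediate.
Proof.
rewrite (_ : intermediate = [set x | 0 < f x] `&` [set x | f x < 1]).
  by apply: measurableI; apply: measurable_lt_set => //; exact: df.1.
by apply/seteqP; split => x; rewrite /intermediate /=; [move=> /andP | move=> ?; apply/andP].
Qed.

(** If [f] were 1 almost everywhere on [C], its mass would be at least the measure
    of [C]. *)
Lemma large_set_not_saturated (C : set V) : measurable C -> (m%:E < leb C)%E ->
  leb (C `&` [set x | f x < 1]) != 0%E.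
Proof.
move=> mC mC1; apply/eqP => C0.
have [[_ _ fm] _] := fopt.
suff : (leb C <= mass f)%E by rewrite fm leNgt mC1.
rewrite -[X in leb X]setIT -integral_indic//; apply: ae_ge0_le_integral => //.
- by apply/measurable_EFinP/measurable_indic.
- by move=> x _; rewrite lee_fin; exact: df.2.
- by apply/measurable_EFinP; exact: df.1.
exists (C `&` [set x | f x < 1]); split => //.
- by apply: measurableI => //; apply: measurable_lt_set => //; exact: df.1.
- move=> x /= nx; have [xC|xC] := pselect (C x).
    split => //; rewrite ltNge; apply/negP => fx; apply: nx => _.
    by rewrite indicE mem_set.
  by exfalso; apply: nx => _; rewrite indicE memNset// lee_fin; exact: df.2.
Qed.

(** On [S] mass can be both added and removed, so two non-null parts of [S] cannot
    be separated by the values of [psi]; the common value is the infimum of the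
    levels below which [S] has a non-null part. *)
Lemma intermediate_level (S : set V) (rho : R) : measurable S ->
  S `<=` intermediate -> S `<=` cball 0 rho -> leb S != 0%E ->
  exists la, leb (S `&` [set x | psi x != la]) = 0%E.
Proof.
move=> mS SI Sr S0.
have mpsi := measurable_psi.
have mle (al : R) : measurable [set x | psi x <= al].
  exact: measurable_le_set.
have mge (al : R) : measurable [set x | al <= psi x].
  exact: measurable_le_set.
pose T := [set al : R | leb (S `&` [set x | psi x <= al]) != 0%E].
have T0 : T !=set0.
  have [k kP] : exists k, leb (S `&` [set x | psi x <= k%:R]) != 0%E.
    apply: measure_pos_bigcup => // x _; exists (Num.Def.archi_bound (psi x)) => //=.
    by apply/ltW/archi_boundP/psi_ge0.
  by exists k%:R.
have Tlb : lbound T 0.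
  move=> al; apply: contraLR; rewrite -ltNge negbK => al0; apply/eqP.
  rewrite (_ : _ `&` _ = set0) ?measure0//; apply/seteqP; split => // x [_ /= h].
  by have := psi_ge0 x; rewrite leNgt (le_lt_trans h).
have infT : has_inf T by split => //; exists 0.
exists (inf T).
have low k : leb (S `&` [set x | psi x <= inf T - k.+1%:R^-1]) = 0%E.
  apply/eqP; apply: contraT => h.
  have : inf T <= inf T - k.+1%:R^-1 by apply: ge_inf => //; exists 0.
  by rewrite lerBrDr gerDl leNgt invr_gt0 ltr0n.
have high k : leb (S `&` [set x | inf T + k.+1%:R^-1 <= psi x]) = 0%E.
  have k0 : 0 < k.+1%:R^-1 :> R by rewrite invr_gt0.
  have [al aT alk] := inf_adherent k0 infT.
  set A := _ `&` _; set B := S `&` [set x | psi x <= al].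
  have [//|B0] : leb A = 0%E \/ leb B = 0%E.
    apply: (@optimal_psi_order al (inf T + k.+1%:R^-1) rho) => //.
    - by rewrite /A; apply: measurableI => //; exact: mge.
    - by rewrite /B; apply: measurableI => //; exact: mle.
    - by move=> x [/Sr].
    - by move=> x [/Sr].
    - by move=> x [/SI/andP[]].
    - by move=> x [/SI/andP[]].
  by move: aT; rewrite /T /= -/B B0 eqxx.
apply/negligibleP.
  apply: measurableI => //; rewrite -[X in measurable X]setTI.
  rewrite (_ : [set x | psi x != inf T] = psi @^-1` [set~ inf T]).
    by apply: mpsi => //; apply: measurableC.
  by apply/seteqP; split => x /eqP.
have N : leb.-negligible (\bigcup_k ((S `&` [set x | psi x <= inf T - k.+1%:R^-1]) `|`
    (S `&` [set x | inf T + k.+1%:R^-1 <= psi x]))).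
  apply: negligible_bigcup => k; apply: negligibleU.
    by apply/negligibleP; [apply: measurableI => //; exact: mle | exact: low].
  by apply/negligibleP; [apply: measurableI => //; exact: mge | exact: high].
apply: (negligibleS _ N) => x [Sx /=]; rewrite neq_lt => /orP[xl|xl].
  have d0 : 0 < inf T - psi x by rewrite subr_gt0.
  have [k kP] := natSinv_le d0.
  by exists k => //; left; split => //=; rewrite lerBrDr addrC -lerBrDr.
have d0 : 0 < psi x - inf T by rewrite subr_gt0.
have [k kP] := natSinv_le d0.
by exists k => //; right; split => //=; rewrite addrC -lerBrDr.
Qed.

End one_minimizer.
End no_intermediate_values.

Section localisation.
Context {R : realType} {n : nat}.
Local Notation V := 'rV[R]_n.
Local Notation leb := (lebesgue_rV R n).
Variable g : V -> R.
Hypothesis cg : continuous g.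
Hypothesis g0 : forall x, 0 <= g x.
Hypothesis ge : forall x, g (- x) = g x.
Variables (m : nat -> R) (f : nat -> V -> R) (mu : probability V R) (r : R).
Hypothesis m0 : forall j, 0 < m j.
Hypothesis m_cvg : m @ \oo --> 0.
Hypothesis fopt : forall j, optimal g (m j) (f j).
Hypothesis fmu : weak_star_cvg (fun j x => (m j)^-1 * f j x) mu.
Hypothesis supp : \forall j \near \oo, mass (cutoff (f j) (~` cball 0 r)) = 0%E.

Let fc j : competitor (m j) (f j). Proof. by have [] := fopt j. Qed.
Local Notation L := (density_mean m f).
Local Notation Lmu := (fun p : V -> R => \int[mu]_x p x).

Let cball_sub (x0 y0 : V) d : cball x0 d `<=` cball 0 (`|x0| + `|y0| + d).
Proof.
move=> x; rewrite /cball /= subr0 => xd.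
rewrite -(subrK x0 x) (le_trans (ler_normD _ _))// addrC -addrA lerD//.
by rewrite (le_trans xd)// lerDr.
Qed.

Let convolve_cvg h x : continuous h -> convolve (L j) h x @[j --> \oo] --> convolve Lmu h x.
Proof.
move=> ch; apply: (density_mean_cvg m0 fc fmu supp).
exact: (continuous_reflect (c := x) ch).
Qed.

Let convolve_close h x e : continuous h -> 0 < e ->
  \forall j \near \oo, `|convolve (L j) h x - convolve Lmu h x| <= e.
Proof.
move=> ch e0; have /cvgrPdist_le/(_ e e0) := convolve_cvg (x := x) ch.
by apply: filterS => j; rewrite distrC.
Qed.

Let potentialE : \forall j \near \oo, forall x,
  density_potential g (f j) x = (m j * convolve (L j) g x)%:E.
Proof.
by apply: filterS supp => j sj x; exact: (density_potential_mean m0 fc x cg sj).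
Qed.

(** Mass near [x0] could be moved to the vicinity of [z0], where [f j < 1] on a
    non-null set since [m j] is smaller than the measure of a fixed ball. *)
Lemma negligible_where_potential_large (x0 z0 : V) :
  convolve Lmu g z0 < convolve Lmu g x0 -> exists2 d, 0 < d &
  \forall j \near \oo, leb.-negligible (cball x0 d `&` intermediate (f j)).
Proof.
move=> z0x0; pose e := (convolve Lmu g x0 - convolve Lmu g z0) / 5.
have e0 : 0 < e by rewrite divr_gt0// subr_gt0.
have eE : 5 * e = convolve Lmu g x0 - convolve Lmu g z0 by rewrite mulrC divfK.
have [d1 d10 d1P] := convolve_equicontinuous r x0 cg e0.
have [d2 d20 d2P] := convolve_equicontinuous r z0 cg e0.
pose d := Num.min d1 d2.
have d0 : 0 < d by rewrite lt_min d10.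
exists d => //; near=> j.
have Lj : mean_on (cball 0 r) (L j).
  by near: j; exact: (density_mean_on m0 fc supp).
have fE : forall x, density_potential g (f j) x = (m j * convolve (L j) g x)%:E by near: j.
have mj1 : m j <= 1 by apply: ltW; near: j; exact: cvgr0_near_lt.
have mjB : m j < fine (leb (cball z0 d)).
  near: j; apply: cvgr0_near_lt => //; apply: fine_gt0.
  by rewrite lebesgue_cball_gt0//= lebesgue_cball_lty.
have xj : `|convolve (L j) g x0 - convolve Lmu g x0| <= e.
  by near: j; exact: convolve_close.
have zj : `|convolve (L j) g z0 - convolve Lmu g z0| <= e.
  by near: j; exact: convolve_close.
pose al := convolve Lmu g z0 + 2 * e; pose be := convolve Lmu g x0 - 2 * e.
have albe : al < be by rewrite /al /be; lra.
have large x : cball x0 d x -> be <= convolve (L j) g x.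
  move=> xd; have := d1P _ x Lj (le_trans xd _); rewrite /be ge_min lexx => /(_ isT).
  move: xj; rewrite !ler_norml => /andP[a _] /andP[b _]; lra.
have low x : cball z0 d x -> convolve (L j) g x <= al.
  move=> xd; have := d2P _ x Lj (le_trans xd _); rewrite /al ge_min lexx orbT => /(_ isT).
  move: zj; rewrite !ler_norml => /andP[_ a] /andP[_ b]; lra.
have mI := measurable_intermediate (fopt j).
have mB x : measurable (cball (x : V) d) by exact: measurable_cball.
have mf : measurable_fun setT (f j) by have [[]] := fc j.
have mlt : measurable [set x | f j x < 1] by exact: measurable_lt_set.
have B0 : leb (cball z0 d `&` [set x | f j x < 1]) != 0%E.
  apply: (large_set_not_saturated (fopt j)) => //.
  by rewrite -lte_fin fineK// in mjB; rewrite ge0_fin_numE// lebesgue_cball_lty.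
apply/negligibleP; first exact: measurableI.
have [//|B00] : leb (cball x0 d `&` intermediate (f j)) = 0%E \/
    leb (cball z0 d `&` [set x | f j x < 1]) = 0%E.
  apply: (optimal_psi_order cg g0 ge (m0 j) mj1 (fopt j) fE albe
    (rho := `|x0| + `|z0| + d)).
  - exact: measurableI.
  - exact: measurableI.
  - by move=> x [h _]; exact: (@cball_sub x0 z0 d x h).
  - by move=> x [h _]; have := @cball_sub z0 x0 d x h; rewrite (addrC `|x0|).
  - by move=> x [/large ? /andP[? _]].
  - by move=> x [/low ? ?].
by rewrite B00 eqxx in B0.
Unshelve. all: by end_near. Qed.

(** The set in question is, up to a null set, contained in one level set of the
    potential, and this one has no three points on a line parallel to [v]. *)
Lemma negligible_where_convex (x0 v : V) (k w : V -> R) :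
  continuous w -> (forall x, has_dd g x v (k x)) -> (forall x, has_dd k x v (w x)) ->
  0 < convolve Lmu w x0 -> exists2 d, 0 < d &
  \forall j \near \oo, leb.-negligible (cball x0 d `&` intermediate (f j)).
Proof.
move=> cw gk kw w0; pose e := convolve Lmu w x0 / 2.
have e0 : 0 < e by rewrite divr_gt0.
have [d d0 dP] := convolve_no_three_levels r x0 cg cw e0 gk kw.
exists d => //; near=> j.
have Lj : mean_on (cball 0 r) (L j).
  by near: j; exact: (density_mean_on m0 fc supp).
have fE : forall x, density_potential g (f j) x = (m j * convolve (L j) g x)%:E by near: j.
have mj1 : m j <= 1 by apply: ltW; near: j; exact: cvgr0_near_lt.
have ew : e < convolve (L j) w x0.
  near: j; apply: (cvgr_gt _ (convolve_cvg (x := x0) cw)).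
  by rewrite /e ltr_pdivrMr// ltr_pMr// ltr1n.
have mI := measurable_intermediate (fopt j).
have mB : measurable (cball x0 d) by exact: measurable_cball.
set S := cball x0 d `&` intermediate (f j).
have mS : measurable S by exact: measurableI.
have Sr : S `<=` cball 0 (`|x0| + `|x0| + d) by move=> x [h _]; exact: (@cball_sub x0 x0 d x h).
apply/negligibleP => //.
have [//|S0] := eqVneq (leb S) 0%E.
have SI : S `<=` intermediate (f j) by move=> x [].
have [la laP] := intermediate_level cg g0 ge (m0 j) mj1 (fopt j) fE mS SI Sr S0.
have mpsi := measurable_psi cg g0 (m0 j) (fopt j) fE.
have mlev : measurable [set x | convolve (L j) g x = la].
  by rewrite -[X in measurable X]setTI; exact: (mpsi measurableT [set la] (measurable_set1 la)).
have lev0 : leb (S `&` [set x | convolve (L j) g x = la]) = 0%E.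
  apply: (@lebesgue_null_of_lines _ _ _ v (`|x0| + `|x0| + d)).
  - exact: measurableI.
  - by move=> x [/Sr].
  move=> x s t s0 st [[xd _] xl] [_ xs] [[xtd _] xt].
  by apply: (dP (L j) x s t) => //; rewrite xl.
have mlevC : measurable [set x | convolve (L j) g x != la].
  rewrite (_ : [set x | _] = ~` [set x | convolve (L j) g x = la]); first exact: measurableC.
  by apply/seteqP; split => x /eqP.
apply/negligibleP => //.
have N : leb.-negligible ((S `&` [set x | convolve (L j) g x = la]) `|`
    (S `&` [set x | convolve (L j) g x != la])).
  by apply: negligibleU; apply/negligibleP => //; exact: measurableI.
apply: (negligibleS _ N) => x Sx.
by have [xl|xl] := eqVneq (convolve (L j) g x) la; [left|right].
Unshelve. all: by end_near. Qed.

(** The radii [d] do not depend on [j], so that finitely many of these balls cover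
    the large one and the finitely many ranks from which on the sets are
    negligible have a maximum. *)
Lemma negligible_of_local (F : nat -> set V) :
  (forall x0 : V, cball 0 r x0 -> exists2 d, 0 < d &
    \forall j \near \oo, leb.-negligible (cball x0 d `&` F j)) ->
  \forall j \near \oo, leb.-negligible (cball 0 r `&` F j).
Proof.
move=> loc.
have rad (x : V) : exists d, 0 < d /\ (cball 0 r x ->
    \forall j \near \oo, leb.-negligible (cball x d `&` F j)).
  have [xr|xr] := pselect (cball 0 r x); last by exists 1.
  by have [d d0 dP] := loc x xr; exists d.
have /choice[rho rhoP] := rad.
have : cover_compact (cball (0 : V) r) by rewrite -compact_cover; exact: compact_cball.
move=> /(_ V (cball 0 r) (fun x => ball x (rho x))) [].
- by move=> x _; exact: ball_open.
- by move=> x xr; exists x => //; apply: ballxx; have [] := rhoP x.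
move=> D Dr Dcov.
have : \forall j \near \oo, forall x : V, x \in D -> leb.-negligible (cball x (rho x) `&` F j).
  have H := @filter_bigI _ V D (fun x : V => [set j | leb.-negligible (cball x (rho x) `&` F j)]) \oo _.
  have {}H : \oo (\bigcap_(x in [set` D]) [set j | leb.-negligible (cball x (rho x) `&` F j)]).
    apply: H => x xD; have [_] := rhoP x; apply.
    by apply: set_mem; exact: Dr.
  by apply: filterS H => j Hj x xD; exact: Hj.
apply: filterS => j Dj.
have N : leb.-negligible (\big[setU/set0]_(x <- D | x \in D) (cball x (rho x) `&` F j)).
  by elim/big_ind : _ => [|A B NA NB|x xD]; [exact: negligible_set0 | exact: negligibleU | exact: Dj].
apply: (negligibleS _ N) => y [yr Fy].
have [x xD xy] := Dcov y yr.
rewrite -big_filter.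
rewrite -bigcup_seq; exists x => /=; first by rewrite mem_filter xD.
split => //; rewrite /cball /= distrC; apply: ltW.
by move: xy; rewrite -ball_normE.
Qed.

End localisation.

(** * Proof of the theorem *)
Section reductions.
Context {R : realType} {n : nat}.
Local Notation V := 'rV[R]_n.
Local Notation leb := (lebesgue_rV R n).

Lemma enormN (x : V) : enorm (- x) = enorm x.
Proof. by rewrite /enorm; congr Num.sqrt; apply: eq_bigr => i _; rewrite !mxE sqrrN. Qed.

Lemma weak_star_cvg_ae (u u' : nat -> V -> R) (mu : {measure set V -> \bar R}) :
  (forall j, measurable_fun setT (u j)) -> (forall j, measurable_fun setT (u' j)) ->
  (forall j, {ae leb, forall x, u j x = u' j x}) ->
  weak_star_cvg u mu -> weak_star_cvg u' mu.
Proof.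
move=> mu_ mu' uu' umu p cp kp.
have mp := continuous_measurable_rV cp.
have -> : (fun j => \int[leb]_x (p x * u' j x)) = (fun j => \int[leb]_x (p x * u j x)).
  apply/funext => j; rewrite /Rintegral; congr fine; apply: ae_eq_integral => //.
  - by apply/measurable_EFinP; exact: measurable_funM.
  - by apply/measurable_EFinP; exact: measurable_funM.
  - by apply: filterS (uu' j) => x -> _.
exact: umu.
Qed.

Lemma has_dd_addc (g : V -> R) c z v d : has_dd g z v d -> has_dd (fun x => g x + c) z v d.
Proof.
move=> gd e e0; have [r r0 rP] := gd e e0; exists r => // h hr.
by rewrite (_ : g (z + h *: v) + c - (g z + c) = g (z + h *: v) - g z) ?rP//; ring.
Qed.

Lemma minimizers_supported_in_ball (g : V -> R) (m : nat -> R) (f : nat -> V -> R)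
    (mu : probability V R) :
  continuous g -> (forall x, 0 <= g x) -> (forall x, g (- x) = g x) ->
  (forall M, exists2 r, 0 <= r & forall x, r <= `|x| -> M <= g x) ->
  (forall j, 0 < m j) -> nonincreasing_seq m -> m @ \oo --> 0 ->
  (forall j, optimal g (m j) (f j)) ->
  weak_star_cvg (fun j x => (m j)^-1 * f j x) mu ->
  exists2 r, 0 <= r & \forall j \near \oo, mass (cutoff (f j) (~` cball 0 r)) = 0%E.
Proof.
move=> cg g0 ge gdiv m0 mni mcvg fopt fmu.
have fc j : competitor (m j) (f j) by have [] := fopt j.
have [R0 R00 tight] := tight_vague_limit m0 fc fmu.
have [R1 R01 loss] := mass_loss_vanishes cg g0 ge gdiv m0 mni mcvg fopt tight.
have R10 : 0 <= R1 by exact: le_trans R01.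
have [R2 [R12 [d d0 esc]]] := optimal_no_escape cg g0 ge gdiv R10.
exists R2; first exact: le_trans R12.
near=> j; apply: (esc (m j)) => //; last by near: j; exact: loss.
by apply: ltW; near: j; apply: cvgr0_near_lt.
Unshelve. all: by end_near. Qed.

Lemma integrable_supported (mu : probability V R) r (p : V -> R) :
  mu (~` cball 0 r) = 0%E -> continuous p -> mu.-integrable setT (EFin \o p).
Proof.
move=> mur cp; have := @integrable_weighted R n mu (fun=> 1) r.
move=> H.
suff : mu.-integrable setT (EFin \o (fun x => p x * 1)).
  by apply: eq_integrable => // x _ /=; rewrite mulr1.
apply: H => //.
  by rewrite integral_cst// mul1e; exact: probability_setT.
exists (~` cball 0 r); split => //.
- by apply: measurableC; exact: measurable_cball.
- by move=> x /= nx xB; apply: nx.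
Qed.

(** An average is at least the minimum over the ball. *)
Lemma mean_ge_some_value (L : (V -> R) -> R) r (p : V -> R) : 0 <= r ->
  mean_on (cball 0 r) L -> continuous p -> exists z, p z <= L p.
Proof.
move=> r0 ML cp.
have [|z _ zmin] := EVT_min_rV _ (@compact_cball R n 0 r) (continuous_subspaceT cp).
  by exists 0; rewrite /cball /= subrr normr0.
exists z; have [_ _ L1] := ML; have := mean_affine ML 0 (p z) cp.
rewrite mul0r add0r => <-; apply: (mean_le ML) => //.
  by apply: continuous_linear2 => //; exact: continuous_const.
by move=> y yr; rewrite mul0r add0r zmin// inE.
Qed.

End reductions.

Theorem theorem3p2 (R : realType) (N : nat) (g : 'rV[R]_N -> R)
    (m : nat -> R) (f : nat -> 'rV[R]_N -> R) (mu : probability 'rV[R]_N R) :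
  (1 <= N)%N ->
  Ck 2 g ->
  definitively_nondecreasing g ->
  diverges_at_infinity g ->
  (forall j, 0 < m j) ->
  nonincreasing_seq m ->
  m @ \oo --> 0 ->
  (forall j, minimizer g (m j) (f j)) ->
  weak_star_cvg (fun j x => (m j)^-1 * f j x) mu ->
  (forall x, ~ spt mu x -> (measure_energy g mu < potential g mu x)%E) ->
  (forall x, spt mu x -> exists2 v : 'rV[R]_N, enorm v = 1 &
     0 < 'D_v ('D_v (fine \o potential g mu)) x) ->
  \forall j \near \oo, is_characteristic (f j).
Proof.
move=> _ C2 [G [gG _]] gdiv m0 mni mcvg fmin fmu off_spt on_spt.
have cg : continuous g by case: C2.
have [c c0 gc0] := diverges_bounded_below cg gdiv.
pose gc x := g x + c.
have cgc : continuous gc by move=> x; apply: continuousD; [exact: cg | exact: cst_continuous].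
have gce x : gc (- x) = gc x by rewrite /gc !gG enormN.
have gcdiv M : exists2 r, 0 <= r & forall x, r <= `|x| -> M <= gc x.
  have [r r0 rP] := diverges_sup_norm gdiv M.
  by exists r => // x /rP h; rewrite /gc (le_trans h)// lerDl.
have /choice[h hP] : forall j, exists h, optimal gc (m j) h /\
    {ae lebesgue_rV R N, forall x, f j x = h x}.
  by move=> j; have [h hopt fh] := minimizer_optimal cg c0 gc0 (fmin j); exists h.
have hopt j : optimal gc (m j) (h j) by have [] := hP j.
have fh j : {ae lebesgue_rV R N, forall x, f j x = h j x} by have [] := hP j.
have hc j : competitor (m j) (h j) by have [] := hopt j.
have dh j : density (h j) by have [] := hc j.
have hmu : weak_star_cvg (fun j x => (m j)^-1 * h j x) mu.
  apply: weak_star_cvg_ae fmu => j.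
  - apply: measurable_funM => //.
    by have [[/integrableP[/measurable_EFinP]]] := fmin j.
  - by apply: measurable_funM => //; exact: (dh j).1.
  - by apply: filterS (fh j) => x ->.
have [r r0 supp] := minimizers_supported_in_ball cgc gc0 gce gcdiv m0 mni mcvg hopt hmu.
have mur := vague_limit_support m0 hc hmu supp.
pose L (p : 'rV[R]_N -> R) := \int[mu]_x p x.
have ML : mean_on (cball 0 r) L := limit_mean_on m0 hc hmu supp.
have finE : fine \o potential g mu = convolve L g by [].
have potE x : potential g mu x = (convolve L g x)%:E.
  have ig := integrable_supported mur (continuous_reflect (c := x) cg).
  by rewrite /convolve /L /Rintegral fineK//; exact: (integrable_fin_num measurableT ig).
have csm : continuous (convolve L g).
  apply/continuousP_norm => x e e0; have [d d0 dP] := convolve_equicontinuous r x cg e0.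
  by exists d => // y; exact: dP.
have enE : measure_energy g mu = (L (convolve L g))%:E.
  have ig := integrable_supported mur csm.
  rewrite /L /Rintegral fineK; last exact: (integrable_fin_num measurableT ig).
  by apply: eq_integral => x _; rewrite -potE.
have [z0 z0E] := mean_ge_some_value r0 ML csm.
have convolvec x : convolve L gc x = convolve L g x + c.
  have := mean_affine ML 1 c (continuous_reflect (c := x) cg); rewrite mul1r => <-.
  by congr L; apply/funext => y; rewrite mul1r.
have null : \forall j \near \oo,
    (lebesgue_rV R N).-negligible (cball 0 r `&` intermediate (h j)).
  apply: negligible_of_local => x0 _.
  have [sx|nsx] := pselect (spt mu x0); last first.
    apply: (negligible_where_potential_large cgc gc0 gce m0 mcvg hopt hmu supp (z0 := z0)).
    rewrite !convolvec ltrD2r; apply: le_lt_trans z0E _.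
    by have := off_spt _ nsx; rewrite enE potE lte_fin.
  have [v _ pos] := on_spt _ sx.
  have [k [w [ck cw gk kw]]] := Ck2_has_dd v C2.
  apply: (negligible_where_convex cgc gc0 gce m0 mcvg hopt hmu supp (k := k) (w := w) (v := v)) => //.
    by move=> x; exact: has_dd_addc.
  move: pos; rewrite finE.
  rewrite (_ : 'D_v (convolve L g) = convolve L k); last first.
    by apply/funext => x; apply: has_dd_derive; exact: convolve_has_dd ML cg ck gk.
  by rewrite (has_dd_derive (convolve_has_dd x0 ML ck cw kw)).
near=> j.
have [suppj nullj] : mass (cutoff (h j) (~` cball 0 r)) = 0%E /\
    (lebesgue_rV R N).-negligible (cball 0 r `&` intermediate (h j)).
  by split; near: j.
have mB : measurable (cball (0 : 'rV[R]_N) r) by exact: measurable_cball.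
have off := mass_eq0 (density_cutoff (dh j) (measurableC mB)) suppj.
have mh := (dh j).1.
exists [set x | 1 <= h j x]; first exact: measurable_le_set.
have inter : {ae lebesgue_rV R N, forall x, ~ (cball 0 r x /\ intermediate (h j) x)}.
  by apply: (negligibleS _ nullj) => x /= /contrapT.
have comb x : f j x = h j x -> cutoff (h j) (~` cball 0 r) x = 0 ->
    ~ (cball 0 r x /\ intermediate (h j) x) -> f j x = \1_[set x | 1 <= h j x] x.
  move=> -> hoff hin; rewrite indicE.
  have [h1|h1] := leP 1 (h j x).
    rewrite mem_set//=; apply/eqP; rewrite eq_le h1 andbT.
    by have [_ /(_ x)] := hc j.
  rewrite memNset/=; last by apply/negP; rewrite -ltNge.
  have [xB|xB] := pselect (cball 0 r x); last first.
    by move: hoff; rewrite /cutoff indicE mem_set// mulr1.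
  apply/eqP; rewrite eq_le (dh j).2 andbT leNgt; apply/negP => h0.
  by apply: hin; split => //; rewrite /intermediate /= h0.
by move: (fh j) off inter; apply: filterS3.
Unshelve. all: by end_near. Qed.
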